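(* As $n\to\infty$, the proportion of all $n$-element semigroups which are dualisable approaches $0$. That is, if $s(n)$ is the number of associative binary operations on $\{1,\dots,n\}$ and $d(n)$ is the number of those for which the resulting semigroup is dualisable, then $d(n)/s(n)\to 0$ as $n\to\infty$.
   Context: Semigroups are algebras with a single binary operation. Duality notions. Let $\mathbf{M}$ be a finite algebra and $\mathcal{Q}=\mathsf{ISP}(\mathbf{M})$ the quasivariety it generates (isomorphic copies of subalgebras of direct powers of $\mathbf{M}$). An alter ego $\mathbb{M}$ of $\mathbf{M}$ is a structure on the same universe $M$, carrying the discrete topology and some finitary operations, partial operations and relations, such that each $n$-ary operation is a homomorphism $\mathbf{M}^n\to\mathbf{M}$, each $n$-ary relation is a subalgebra of $\mathbf{M}^n$, and each $n$-ary partial operation is a homomorphism from a subalgebra of $\mathbf{M}^n$ into $\mathbf{M}$. Let $\mathcal{X}=\mathsf{IS_cP^+}(\mathbb{M})$ be the class of topologically and algebraically isomorphic copies of closed substructures of powers of $\mathbb{M}$ over nonempty index sets (product topology, pointwise structure). For $\mathbf{A}\in\mathcal{Q}$, $D(\mathbf{A})=\hom(\mathbf{A},\mathbf{M})$, a closed substructure of $\mathbb{M}^A$; for $\mathbb{A}\in\mathcal{X}$, $E(\mathbb{A})$ is the algebra of continuous homomorphisms (structure-preserving maps) $\mathbb{A}\to\mathbb{M}$, a subalgebra of $\mathbf{M}^{\mathbb{A}}$. $\mathbb{M}$ yields a duality on $\mathbf{A}$ if the (always injective) evaluation homomorphism $e:\mathbf{A}\to E(D(\mathbf{A}))$, $e_a(x)=x(a)$,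 is an isomorphism. $\mathbf{M}$ is dualisable (admits a natural duality) if some alter ego of $\mathbf{M}$ yields a duality on every $\mathbf{A}\in\mathcal{Q}$. *)

(* Defs.v *)
From mathcomp Require Import all_boot all_order all_algebra.
From mathcomp Require Import all_classical all_reals all_analysis.

Set Implicit Arguments.
Unset Strict Implicit.
Unset Printing Implicit Defensive.

Local Open Scope classical_set_scope.

(* Algebras with one binary operation: a carrier and its multiplication.
   Algebras are nonempty. *)

Definition hom (A B : Type) (mulA : A -> A -> A) (mulB : B -> B -> B)
    (f : A -> B) : Prop :=
  {morph f : x y / mulA x y >-> mulB x y}.

Definition subalgebra (A : Type) (mul : A -> A -> A) (B : set A) : Prop :=
  B !=set0 /\ forall x y, B x -> B y -> B (mul x y).

Definition pow_mul (M I : Type) (mul : M -> M -> M) (x y : I -> M) : I -> M :=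
  fun i => mul (x i) (y i).

Definition iso_onto (A C : Type) (mulA : A -> A -> A) (mulC : C -> C -> C)
    (B : set C) (f : A -> C) : Prop :=
  [/\ subalgebra mulC B, hom mulA mulC f & set_bij [set: A] B f].

Definition in_ISP (M : Type) (mul : M -> M -> M)
    (A : Type) (mulA : A -> A -> A) : Prop :=
  exists (I : Type) (B : set (I -> M)) (f : A -> I -> M),
    iso_onto mulA (pow_mul mul) B f.

(* A partial operation is an option-valued function, defined where its value
   is a Some. *)
Record structure (M : Type) := Structure {
  ops : forall n, set (('I_n -> M) -> M);
  pops : forall n, set (('I_n -> M) -> option M);
  rels : forall n, set (set ('I_n -> M)) }.

Definition partial_hom (M : Type) (mul : M -> M -> M) (n : nat)
    (h : ('I_n -> M) -> option M) : Prop :=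
  subalgebra (pow_mul mul) [set x | exists a, h x = Some a] /\
  forall x y a b, h x = Some a -> h y = Some b ->
    h (pow_mul mul x y) = Some (mul a b).

Definition alter_ego (M : Type) (mul : M -> M -> M) (S : structure M) : Prop :=
  [/\ forall n g, @ops M S n g -> hom (pow_mul mul) mul g,
      forall n h, @pops M S n h -> partial_hom mul h
    & forall n r, @rels M S n r -> subalgebra (pow_mul mul) r].

Definition substructure (M I : Type) (S : structure M) (X : set (I -> M)) :=
  (forall n g (x : 'I_n -> I -> M) (y : I -> M), @ops M S n g ->
     (forall k, X (x k)) -> (forall i, g (x ^~ i) = y i) -> X y) /\
  (forall n h (x : 'I_n -> I -> M) (y : I -> M), @pops M S n h ->
     (forall k, X (x k)) -> (forall i, h (x ^~ i) = Some (y i)) -> X y).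

Section Duality.
Variables (M : finType) (mul : M -> M -> M) (S : structure M).

(* Structure-preserving maps X -> M, where X has the structure induced by the
   power M^I; "y = g(x_0, ..., x_(n-1)) in X" is read coordinatewise. *)
Definition structure_hom (I : Type) (X : set (I -> M)) (f : X -> M) : Prop :=
  [/\ forall n g (x : 'I_n -> X) (y : X), @ops M S n g ->
        (forall i, g (fun k => set_val (x k) i) = set_val y i) ->
        g (f \o x) = f y,
      forall n h (x : 'I_n -> X) (y : X), @pops M S n h ->
        (forall i, h (fun k => set_val (x k) i) = Some (set_val y i)) ->
        h (f \o x) = Some (f y)
    & forall n r (x : 'I_n -> X), @rels M S n r ->
        (forall i, r (fun k => set_val (x k) i)) ->
        r (f \o x)].

(* The topology on X is the subspace topology of the product of discrete
   spaces. *)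
Definition E (I : Type) (X : set {ptws I -> discrete_topology M}) :
    set (X -> M) :=
  [set f | continuous (f : X -> discrete_topology M) /\ structure_hom f].

Definition D (A : Type) (mulA : A -> A -> A) :
    set {ptws A -> discrete_topology M} :=
  [set x | hom mulA mul x].

Definition eval (A : Type) (mulA : A -> A -> A) (a : A) : D mulA -> M :=
  fun x => set_val x a.

Definition yields_duality_on (A : Type) (mulA : A -> A -> A) : Prop :=
  iso_onto mulA (pow_mul mul) (@E A (D mulA)) (@eval A mulA).

End Duality.

Definition dualisable (M : finType) (mul : M -> M -> M) : Prop :=
  exists2 S : structure M, alter_ego mul S &
    forall (A : Type) (mulA : A -> A -> A),
      in_ISP mul mulA -> yields_duality_on mul S mulA.

(* Facts implicit in the definition of a duality: D(A) is a closed substructure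
   of the power M^A, E(X) is closed under the pointwise multiplication, and
   evaluation is an embedding of A into E(D(A)). *)

Lemma D_substructure (M : finType) (mul : M -> M -> M) (S : structure M)
    (A : Type) (mulA : A -> A -> A) :
  alter_ego mul S -> substructure S (D mul mulA).
Proof.
case=> Hg Hh _; split=> n g x y Sg Dx gE a b.
  rewrite -!gE -(Hg _ _ Sg); congr g; apply/funext=> k; exact: Dx.
have [_ /(_ _ _ _ _ (gE a) (gE b))] := Hh _ _ Sg.
suff -> : pow_mul mul (x ^~ a) (x ^~ b) = x ^~ (mulA a b).
  by rewrite gE => -[].
by apply/funext=> k; rewrite /pow_mul Dx.
Qed.

(* proj_continuous assumes an index type with decidable equality. *)
Lemma coord_continuous (I : Type) (T : topologicalType) (i : I) :
  continuous (fun x : {ptws I -> T} => x i).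
Proof.
move=> x U xU; have /cvg_sup/(_ i) : x --> x by exact: cvg_id.
by apply; apply: (@initial_continuous _ _ (fun x : I -> T => x i)).
Qed.

Lemma D_closed (M : finType) (mul : M -> M -> M)
    (A : Type) (mulA : A -> A -> A) : closed (D mul mulA).
Proof.
have -> : D mul mulA = \bigcap_(p in [set: A * A])
    [set x : {ptws A -> discrete_topology M} |
      x (mulA p.1 p.2) = mul (x p.1) (x p.2)].
  apply/seteqP; split=> x /=; first by move=> hx p _; apply: hx.
  by move=> hx a b; apply: (hx (a, b)).
apply: closed_bigI => -[a b] _ /= x clx.
have cx c : nbhs x [set y : {ptws A -> discrete_topology M} | y c = x c].
  apply: (@coord_continuous A (discrete_topology M) c x [set x c]).
  exact: (@discrete_set1 (discrete_topology M)).
have [y [/= yE [[ya yb] yab]]] :=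
  clx _ (filterI (filterI (cx a) (cx b)) (cx (mulA a b))).
by rewrite -ya -yb -yab.
Qed.

Lemma E_mul (M : finType) (mul : M -> M -> M) (S : structure M)
    (I : Type) (X : set {ptws I -> discrete_topology M}) (f g : X -> M) :
  alter_ego mul S -> E S f -> E S g -> E S (pow_mul mul f g).
Proof.
move=> [Ho Hp Hr] [cf [fo fp fr]] [cg [go gp gr]]; split.
  move=> x U /= nU.
  have nf : nbhs x (f @^-1` [set f x]).
    exact: cf x _ (@discrete_set1 (discrete_topology M) _).
  have ng : nbhs x (g @^-1` [set g x]).
    exact: cg x _ (@discrete_set1 (discrete_topology M) _).
  apply: filterS (filterI nf ng) => y /= [fy gy].
  by rewrite /pow_mul fy gy; exact: nbhs_singleton nU.
split=> [n h x y Sh hE|n h x y Sh hE|n r x Sr rE].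
- have := Ho _ _ Sh (f \o x) (g \o x).
  by rewrite (fo _ _ _ _ Sh hE) (go _ _ _ _ Sh hE).
- have [_ hm] := Hp _ _ Sh.
  exact: hm (fp _ _ _ _ Sh hE) (gp _ _ _ _ Sh hE).
- have [_ rm] := Hr _ _ Sr.
  exact: rm (fr _ _ _ Sr rE) (gr _ _ _ Sr rE).
Qed.

Lemma eval_E (M : finType) (mul : M -> M -> M) (S : structure M)
    (A : Type) (mulA : A -> A -> A) (a : A) :
  E S (@eval M mul A mulA a).
Proof.
split.
  move=> x; apply: (@continuous_comp (D mul mulA)
      {ptws A -> discrete_topology M} (discrete_topology M)
      set_val (fun y => y a)).
    exact: initial_continuous.
  exact: coord_continuous.
by split=> n g x => [y|y|] Sg /(_ a).
Qed.

Lemma eval_hom (M : finType) (mul : M -> M -> M)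
    (A : Type) (mulA : A -> A -> A) :
  hom mulA (pow_mul mul) (@eval M mul A mulA).
Proof. by move=> a b; apply/funext=> x; apply: (set_valP x). Qed.

Lemma eval_inj (M : finType) (mul : M -> M -> M)
    (A : Type) (mulA : A -> A -> A) :
  in_ISP mul mulA -> injective (@eval M mul A mulA).
Proof.
move=> [I [B [f [_ hf [_ fi _]]]]] a b eab.
apply: fi; rewrite ?inE //; apply/funext=> i.
have Df : D mul mulA (f ^~ i) by move=> c d; rewrite hf.
by have := congr1 (@^~ (SigSub (mem_set Df))) eab.
Qed.

(* Semigroups are counted as labelled objects, not up to isomorphism. *)

Definition binop (n : nat) : finType := {ffun 'I_n * 'I_n -> 'I_n}.

Definition binop_mul (n : nat) (op : binop n) (x y : 'I_n) : 'I_n := op (x, y).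

Definition num_semigroups (n : nat) : nat :=
  #|[pred op : binop n | `[< associative (binop_mul op) >]]|.

Definition num_dualisable_semigroups (n : nat) : nat :=
  #|[pred op : binop n |
      `[< associative (binop_mul op) /\ dualisable (binop_mul op) >]]|.

(* Main.v *)
(* Call elements a, a', b, b' with ab = ab' = a'b <> a'b' an elbow.

   A dualisable semigroup has no elbow or satisfies a law xy = w(x, y) other
   than xy = xy. Otherwise, take the lines joining two disjoint infinite sets of
   points L and R, with one more point on each pair of disjoint lines. In a power
   indexed by these points and by all pairs (p, q), let x_l be a' on the line l
   and a off it, let y_l be b' on l and b off it, and at (p, q) let x_l = p and
   y_l = q. Then x_l y_m is ab at all points but the one on both lines, for
   l <> m, so it only depends on that point. In a finite colouring of the lines,
   two lines of the same colour through s in L and two through t in R, one line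
   being common, show that s and t receive the same value; hence all but a bounded
   number of points of L have the same value under any homomorphism. The limit
   value is a continuous structure-preserving map, but it is not the evaluation at
   an element: such an element would be pq at (p, q), so a word x_l y_m in the
   generators for want of a law, and this is a'b' on the intersection of l and m.

   Few semigroups of order n are of either kind, compared with the k ^ (n - k) ^ 2
   semigroups, for k a small fraction of n, in which all products lie in a fixed
   set of k elements and all products of three elements are equal. Let P be the
   set of irreducible elements: those a with a = xy only if x = a or y = a. If
   n - |P| is not small, a fixed proportion of the rows of the multiplication table
   is determined by the others. Otherwise the rows and columns outside P cost
   little, and for a, b in P the product ab is a, b or reducible. Without elbows,
   the cells of each reducible value form disjoint rectangles. If many a in P
   satisfy a = (ay)a with ay reducible, then za = (z(ay))a determines many columns.
   In the remaining case a law xy = w(x, y), which can be taken from a list of ten,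
   determines ab from ba. *)

Require Import Defs.
From mathcomp Require Import all_boot all_order all_algebra.
From mathcomp Require Import all_classical all_reals all_analysis.
From mathcomp Require Import zify.
Import numFieldNormedType.Exports.

Set Implicit Arguments.
Unset Strict Implicit.
Unset Printing Implicit Defensive.

(** * Words and laws *)

Section Words.
Variables (T : Type) (mul : T -> T -> T).

Fixpoint sprod (x : T) (s : seq T) : T :=
  if s is y :: s' then mul x (sprod y s') else x.

Lemma sprod_cat (x y : T) (s t : seq T) : associative mul ->
  sprod x (s ++ y :: t) = mul (sprod x s) (sprod y t).
Proof. by move=> mulA; elim: s x => //= z s IH x; rewrite IH mulA. Qed.

End Words.

(* The value of the nonempty word h :: s, where true stands for x and false for y. *)
Definition word_eval (T : Type) (mul : T -> T -> T) (x y : T) (h : bool) (s : seq bool) : T :=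
  let l (c : bool) := if c then x else y in sprod mul (l h) (map l s).

Definition has_elbow (T : Type) (mul : T -> T -> T) : Prop :=
  exists a a' b b', [/\ mul a b' = mul a b, mul a' b = mul a b & mul a' b' <> mul a b].

(** * Idempotent powers and the reduction of laws to canonical ones *)

Section Identities.
Variables (T : finType) (mul : T -> T -> T).
Hypothesis mulA : associative mul.
Local Notation "x ** y" := (mul x y) (at level 40, left associativity).

Definition pow (x : T) (k : nat) : T := sprod mul x (nseq k x).

Lemma powD x m k : pow x m ** pow x k = pow x (m + k).+1.
Proof. by rewrite /pow -addnS nseqD sprod_cat. Qed.

Lemma powS x k : x ** pow x k = pow x k.+1. Proof. by []. Qed.

Lemma powSr x k : pow x k ** x = pow x k.+1.
Proof. by rewrite -[X in _ ** X]/(pow x 0) powD addn0. Qed.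

Lemma pow_pow x i j : pow (pow x i) j = pow x (i.+1 * j.+1).-1.
Proof.
elim: j => [|j IH]; first by rewrite muln1.
by rewrite -powS IH powD; congr pow; rewrite [in RHS]mulnS mulnS /= !addSn /= -addnS.
Qed.

Lemma pow_idem e k : e ** e = e -> pow e k = e.
Proof. by move=> ee; elim: k => // k IH; rewrite -powS IH. Qed.

(* x ^ (n + 2)! is idempotent in every semigroup of order n; pow counts from x ^ 1. *)
Definition omega (n : nat) := (n.+2)`!.-1.

Local Notation K := (omega #|T|).
Local Notation E x := (pow x K).

Lemma omegaS n : (omega n).+1 = (n.+2)`!. Proof. by rewrite prednK ?fact_gt0. Qed.

Lemma omega_gt n : n < omega n.
Proof. by rewrite -ltnS omegaS factS; apply: leq_pmulr; apply: fact_gt0. Qed.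

(** The powers of x are eventually periodic; (n + 2)! lies past the preperiod and is a multiple of
    the period, which is at most n = |T|. *)
Lemma pow_omega_idem x : E x ** E x = E x.
Proof.
have [i [p [p0 iN pN ipE]]] : exists i p, [/\ 0 < p, i <= #|T|, p <= #|T| & pow x i = pow x (i + p)].
  pose f (i : 'I_#|T|.+1) := pow x i.
  have /injectivePn[i [j ij fE]] : ~~ injectiveb f.
    apply/negP => /injectiveP/leq_card; by rewrite card_ord ltnn.
  wlog lt : i j ij fE / i < j.
    move=> W; have [/W|/W|/val_inj E'] := ltngtP i j; [exact|by apply; rewrite // eq_sym|].
    by rewrite E' eqxx in ij.
  exists i, (j - i); rewrite subn_gt0 lt (subnKC (ltnW lt)); split=> //; first exact: (ltn_ord i).
  exact: leq_trans (leq_subr _ _) (ltn_ord j : j <= #|T|).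
have per q k : i <= k -> pow x k = pow x (k + p * q).
  move=> ik; elim: q => [|q IH]; first by rewrite muln0 addn0.
  rewrite {}IH mulnS addnCA -[in LHS](subnKC ik) -!addnA.
  have -> r : pow x (i + r) = pow x (p + (i + r)).
    case: r => [|r]; first by rewrite addn0 addnC.
    rewrite [i + _]addnS -powD ipE powD; congr pow; by rewrite addnS addnA [p + i]addnC.
  by congr pow; congr addn; rewrite addnA subnKC.
rewrite powD -addnS [in RHS](per ((#|T|.+2)`! %/ p)); last exact: leq_trans iN (ltnW (omega_gt _)).
by rewrite mulnC divnK ?omegaS // dvdn_fact // p0 (leq_trans pN) // leqW.
Qed.

Lemma absorb_pow p q j : p = p ** q -> p = p ** pow q j.
Proof.
move=> pq; elim: j => [|j IH] //.
by rewrite -powS mulA -pq.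
Qed.

(** With N = (n + 2)!, p = p (x^(i+1))^N = p (x^N)^(i+1) = p x^N, as x^N is idempotent. *)
Lemma absorb_omega p x i : p = p ** pow x i -> p = p ** E x.
Proof.
move=> /(absorb_pow K); rewrite pow_pow mulnC -pow_pow.
by rewrite pow_idem // pow_omega_idem.
Qed.

Lemma omega_factor x : exists l, E x = l ** x.
Proof.
case: K (omega_gt #|T|) => // k _; exists (pow x k); by rewrite powSr.
Qed.

Lemma pow_comm x i : pow x i ** x = x ** pow x i.
Proof. by rewrite powSr powS. Qed.

(* Green's R-preorder. *)
Definition rle p q := p = q \/ exists s, p = q ** s.

Lemma rle_trans q p r : rle p q -> rle q r -> rle p r.
Proof.
move=> [->//|[s ->]] [->|[t ->]]; first by right; exists s.
by right; exists (t ** s); rewrite mulA.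
Qed.

Lemma rle_mulr p q : rle (p ** q) p. Proof. by right; exists q. Qed.

Lemma rle_mull x p q : rle p q -> rle (x ** p) (x ** q).
Proof. by move=> [->|[s ->]]; [left|right; exists s; rewrite mulA]. Qed.

Lemma rle_pow p k : rle p (p ** p) -> rle p (pow p k).
Proof.
move=> pp; elim: k => [|k IH]; first by left.
by apply: rle_trans pp _; rewrite -powS; apply: rle_mull.
Qed.

(** Since (xl)(xg) = xgg = xg, the element xl is a left identity for everything below xg, while
    (xl)(xy) = xgy. *)
Lemma rle_sandwich x y g l : g = l ** x -> g ** g = g -> rle (x ** y) (x ** g) ->
  x ** y = x ** g ** y.
Proof.
move=> gE gg.
have key : x ** l ** (x ** g) = x ** g by rewrite -mulA (mulA l) -gE gg.
have -> : x ** g ** y = x ** l ** (x ** y) by rewrite gE !mulA.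
by move=> [->|[s ->]]; rewrite ?key // (mulA (x ** l)) key.
Qed.

Lemma word_eval_cat x y h s c t :
  word_eval mul x y h (s ++ c :: t) = word_eval mul x y h s ** word_eval mul x y c t.
Proof. by rewrite /word_eval map_cat sprod_cat. Qed.

Lemma word_eval_nseq x y c k : word_eval mul x y c (nseq k c) = pow (if c then x else y) k.
Proof. by rewrite /word_eval map_nseq. Qed.

Lemma word_eval_flatten x y h k c u d :
  word_eval mul x y h (flatten (nseq k.+1 (c :: u)) ++ [:: d]) =
  (if h then x else y) ** pow (word_eval mul x y c u) k ** (if d then x else y).
Proof.
have E j : word_eval mul x y c (u ++ flatten (nseq j (c :: u)) ++ [:: d]) =
    pow (word_eval mul x y c u) j ** (if d then x else y).
  elim: j => [|j IH]; first by rewrite /= word_eval_cat.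
  by rewrite /= word_eval_cat -catA IH mulA.
by rewrite -mulA -E /= catA.
Qed.

(* With N = (n + 2)!, these are the words x x^N y, x y y^N, x, y, xx, yy, yx,
   y^N x y, x (yx)^N y and x (y^N x^N)^N y. *)
Definition canonical_words (n : nat) : seq (bool * seq bool) :=
  let k := omega n in
  [:: (true, nseq k.+1 true ++ [:: false]);
      (true, nseq k.+2 false);
      (true, [::]); (false, [::]); (true, [:: true]); (false, [:: false]);
      (false, [:: true]);
      (false, nseq k false ++ [:: true; false]);
      (true, flatten (nseq k.+1 [:: false; true]) ++ [:: false]);
      (true, flatten (nseq k.+1 (nseq k.+1 false ++ nseq k.+1 true)) ++ [:: false])].

Section Law.
Variables (h : bool) (s : seq bool).
Hypothesis law : forall x y, x ** y = word_eval mul x y h s.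
Hypothesis long : 1 < size s.

(** At y = x the law reads x^2 = x^(size s + 1) with exponent at least 3, so x^2 absorbs a positive
    power of x. *)
Lemma law_square x : x ** x = x ** x ** E x.
Proof.
apply: (@absorb_omega _ _ (size s - 2)).
have sE : word_eval mul x x h s = pow x (size s).
  rewrite /word_eval if_same /pow; congr sprod.
  by elim: (s) => //= c t ->; rewrite if_same.
rewrite {1}law sE -[x ** x]/(pow x 1) powD; congr pow.
by rewrite add1n -addn2 subnK.
Qed.

Lemma law_square_omega x : x ** x = E x ** (x ** x).
Proof. by rewrite mulA pow_comm -mulA pow_comm mulA -law_square. Qed.

End Law.

Lemma word_eval_rle x y h s : rle (word_eval mul x y h s) (if h then x else y).
Proof. by case: s => [|c s]; [left|exact: rle_mulr]. Qed.

Local Notation W := (canonical_words #|T|).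
Local Notation canonical :=
  (exists2 w, w \in W & forall x y, x ** y = word_eval mul x y w.1 w.2).

(* A law xy = xyv. If v starts with x, then xy lies in xyxS for all x and y, so in
   (xy)^2 S; if v starts with a power of y followed by x, then xy lies in
   x (y^N x^N)^2 S. In both cases rle_sandwich applies. *)
Lemma canonical_right (h : bool) (s : seq bool) :
  (forall x, x ** x = E x ** (x ** x)) ->
  (forall x y, x ** y = x ** y ** word_eval mul x y h s) -> canonical.
Proof.
move=> sq; case: h => law.
  exists (true, flatten (nseq K.+1 [:: false; true]) ++ [:: false]) => [|x y].
    by rewrite !inE eqxx !orbT.
  have xyx u v : rle (u ** v) (u ** v ** u).
    by rewrite {1}(law u v); apply: rle_mull; exact: word_eval_rle.
  have [l lE] := omega_factor (y ** x).
  rewrite [LHS](@rle_sandwich _ _ (E (y ** x)) (l ** y)).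
  - by rewrite [RHS]word_eval_flatten.
  - by rewrite lE mulA.
  - exact: pow_omega_idem.
  have pp : rle (x ** y) (x ** y ** (x ** y)).
    apply: rle_trans (xyx x y) _; rewrite -!mulA; apply: rle_mull.
    by rewrite mulA.
  apply: rle_trans (rle_pow K.+1 pp) _.
  have -> k : pow (x ** y) k.+1 = x ** pow (y ** x) k ** y.
    elim: k => [|k IH]; first by rewrite -[LHS]/(x ** y ** (x ** y)) !mulA.
    by rewrite -powS IH -powS !mulA.
  exact: rle_mulr.
have [[j sE]|[j [t sE]]] : (exists j, s = nseq j false) \/ exists j t, s = nseq j false ++ true :: t.
- elim: (s) => [|[] r [[j ->]|[j [t ->]]]]; [by left; exists 0| | | |].
  + by right; exists 0, (nseq j false).
  + by right; exists 0, (nseq j false ++ true :: t).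
  + by left; exists j.+1.
  + by right; exists j.+1, t.
- exists (true, nseq K.+2 false) => [|x y]; first by rewrite !inE !eqxx orbT.
  rewrite [LHS](@absorb_omega (x ** y) y j).
    by rewrite (word_eval_cat x y true [::] false (nseq K.+1 false)) word_eval_nseq -mulA.
  by rewrite {1}(law x y) sE word_eval_nseq.
exists (true, flatten (nseq K.+1 (nseq K.+1 false ++ nseq K.+1 true)) ++ [:: false]) => [|x y].
  by rewrite !inE eqxx !orbT.
have L u v : rle (u ** v) (u ** pow v j.+1 ** u).
  rewrite {1}(law u v) sE word_eval_cat word_eval_nseq -powS !mulA; apply: rle_mull.
  exact: word_eval_rle.
have L1 u v : rle (u ** v) (u ** E v).
  apply: rle_trans (L _ _) _.
  have -> : pow v j.+1 = E v ** pow v j.+1.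
    case: j {sE L} => [|j]; first exact: sq.
    by rewrite -!powS !(mulA v v) !mulA -(mulA (E v)) -sq.
  by move: (pow v j.+1) => z; rewrite !mulA -(mulA (u ** E v)); exact: rle_mulr.
have L2 u e : e ** e = e -> rle (u ** e) (u ** e ** u).
  by move=> ee; have := L u e; rewrite pow_idem.
have ff := pow_omega_idem y; have ee := pow_omega_idem x.
set f := E y in ff *; set e := E x in ee *.
have pp : rle (f ** e) (f ** e ** (f ** e)).
  apply: rle_trans (L2 f e ee) _; rewrite -!mulA; apply: rle_mull.
  by rewrite !mulA; exact: L2.
have [l lE] := omega_factor (f ** e); have [m mE] := omega_factor x.
rewrite [LHS](@rle_sandwich _ _ (E (f ** e)) (l ** f ** m)).
- rewrite [RHS]word_eval_flatten; congr (_ ** pow _ _ ** _).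
  by rewrite (word_eval_cat _ _ _ (nseq K false)) !word_eval_nseq.
- by rewrite lE -!mulA -mE.
- exact: pow_omega_idem.
apply: rle_trans (L1 x y) _; apply: rle_trans (L2 x f ff) _.
rewrite -mulA; apply: rle_mull; apply: rle_trans (L1 f x) _.
exact: rle_pow.
Qed.

(** Words of length at most two, other than xy, are in the list. Longer words are sorted by their
    first two letters: xx yields x x^N y, yy yields y^N x y, xy falls under [canonical_right], and
    so does yx after two applications of the law. *)
Lemma canonical_law (h : bool) (s : seq bool) : ~ (h /\ s = [:: false]) ->
  (forall x y, x ** y = word_eval mul x y h s) -> canonical.
Proof.
case: s => [|c [|d s]] n0 law.
- by exists (h, [::]) => //; case: (h); rewrite !inE eqxx ?orbT.
- exists (h, [:: c]) => //; case: (h) (c) n0 => [] []; rewrite ?inE ?eqxx ?orbT //.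
  by case.
have sq1 := law_square law isT; have sq := law_square_omega law isT.
case: h c {n0} law => [] [] /= law.
- exists (true, nseq K.+1 true ++ [:: false]) => [|x y]; first by rewrite !inE eqxx.
  have [l lE] := omega_factor x.
  rewrite [LHS](@rle_sandwich _ _ (E x) l) //; last 2 first.
  + exact: pow_omega_idem.
  + have xx : x ** x = x ** E x ** x by rewrite -mulA pow_comm mulA -sq1.
    by rewrite {1}law /word_eval /= mulA {1}xx -(mulA (x ** E x)); exact: rle_mulr.
  by rewrite word_eval_cat word_eval_nseq.
- apply: (@canonical_right d s) => // x y.
  by rewrite {1}law /word_eval /= mulA.
- apply: (@canonical_right (~~ d) (map negb s ++ d :: s)) => // x y.
  have law' u v : u ** v = v ** u ** word_eval mul u v d s.
    by rewrite {1}law /word_eval /= mulA.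
  rewrite word_eval_cat [LHS]law' (law' y x) [RHS]mulA; congr (_ ** _ ** _).
  rewrite /word_eval -map_comp; congr sprod; first by case: (d).
  by apply: eq_map => -[].
- exists (false, nseq K false ++ [:: true; false]) => [|x y].
    by rewrite !inE eqxx ?orbT.
  have xy : x ** y = y ** y ** word_eval mul x y d s by rewrite [LHS]law /word_eval /= mulA.
  rewrite [RHS]word_eval_cat word_eval_nseq -[word_eval _ _ _ true _]/(x ** y).
  by rewrite {2}xy mulA -sq.
Qed.

End Identities.

(** * Counting maps by codes, and independent sets *)

Section Codes.

(** Each fibre of [code] injects into the maps on [K c], extended by the default [y0]. *)
Lemma card_code (X Y C : finType) (y0 : Y) (D : {set {ffun X -> Y}})
    (code : {ffun X -> Y} -> C) (K : C -> {set X}) (k : nat) :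
  (forall f, f \in D -> #|K (code f)| <= k) ->
  (forall f g, f \in D -> g \in D -> code f = code g ->
     {in K (code f), f =1 g} -> f = g) ->
  #|D| <= #|C| * #|Y| ^ k.
Proof.
move=> Kk inj; rewrite -sum1_card (partition_big code xpredT) //=.
rewrite -sum_nat_const; apply: leq_sum => c _.
have [[f0 /andP[Df0 /eqP cf0]]|none] := pselect (exists f, (f \in D) && (code f == c)); last first.
  by rewrite big_pred0 // => f; apply/negP => Df; apply: none; exists f.
pose r (f : {ffun X -> Y}) := [ffun x => if x \in K c then f x else y0].
rewrite sum1_card.
have rinj : {in [pred f | (f \in D) && (code f == c)] &, injective r}.
  move=> f g /andP[Df /eqP cf] /andP[Dg /eqP cg] rE.
  apply: inj => //; rewrite ?cf ?cg // => x xK.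
  by have := congr1 (fun h : {ffun X -> Y} => h x) rE; rewrite !ffunE xK.
rewrite -(card_in_image rinj).
have Y0 : 0 < #|Y| by apply/card_gt0P; exists y0.
apply: (@leq_trans (#|Y| ^ #|K c|)); last by rewrite leq_pexp2l // -cf0 Kk.
rewrite -[#|Y| ^ _](card_pffun_on y0 (K c) predT).
apply: subset_leq_card; apply/fintype.subsetP => _ /fintype.imageP[f _ ->].
apply/pffun_onP; split=> //; apply/supportP => x /negPf xK.
by rewrite ffunE xK.
Qed.

(* Some vertex of N has at most two predecessors, as there are two arrows out
   of every vertex; it, its two successors and its predecessors are discarded. *)
Lemma independent_fifth (X : finType) (f g : X -> X) (N : {set X}) :
  {in N, forall a, f a != a} -> {in N, forall a, g a != a} ->
  exists F : {set X}, [/\ F \subset N, #|N| <= 5 * #|F| &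
    {in F, forall a, (f a \notin F) && (g a \notin F)}].
Proof.
have [m] := ubnP #|N|; elim: m N => // m IH N /ltnSE-lem fN gN.
have [->|[a0 a0N]] := set_0Vmem N.
  exists finset.set0; split; rewrite ?cards0 ?finset.sub0set //.
  by move=> a; rewrite inE.
have [a aN deg] : exists2 a, a \in N & #|[set b in N | f b == a]| + #|[set b in N | g b == a]| <= 2.
  apply: contrapT => nE.
  have : \sum_(a in N) 3 <= \sum_(a in N) (#|[set b in N | f b == a]| + #|[set b in N | g b == a]|).
    apply: leq_sum => a aN; rewrite ltnNge; apply/negP => le2; apply: nE; by exists a.
  rewrite big_split /= sum_nat_const leqNgt => /negP; apply.
  have le h : \sum_(a in N) #|[set b in N | h b == a]| <= #|N|.
    rewrite -[leqRHS]sum1_card [leqRHS](partition_big h xpredT) //=.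
    apply: (@leq_trans (\sum_(a in N) \sum_(i in N | h i == a) 1)).
      by apply: leq_sum => a _; rewrite sum1dep_card.
    by rewrite [leqRHS](bigID (mem N)) leq_addr.
  apply: leq_ltn_trans (leq_add (le f) (le g)) _.
  rewrite addnn -muln2 ltn_mul2l andbT card_gt0; apply/set0Pn; by exists a0.
pose R := a |: (f a |: (g a |: ([set b in N | f b == a] :|: [set b in N | g b == a]))).
have R5 : #|R| <= 5.
  rewrite /R; do 3 (rewrite cardsU1; apply: leq_add (leq_b1 _) _).
  exact: leq_trans (leq_card_setU _ _) deg.
have aR : a \in R by rewrite !inE eqxx.
have NR : #|N :\: R| < #|N|.
  by apply: proper_card; apply/properP; split; [exact: subsetDl|exists a => //; rewrite finset.in_setD aR].
have sub b : b \in N :\: R -> b \in N by rewrite inE => /andP[].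
have [F [FN NF indF]] := IH (N :\: R) (leq_trans NR lem)
  (fun b bN => fN b (sub b bN)) (fun b bN => gN b (sub b bN)).
have FR b : b \in F -> b \notin R by move=> /(fintype.subsetP FN); rewrite inE => /andP[].
exists (a |: F); split.
- apply/fintype.subsetP => b; rewrite !inE => /predU1P[->//|/(fintype.subsetP FN)/sub //].
- rewrite cardsU1 (contraL (@FR a)) ?aR // mulnDr muln1.
  apply: leq_trans (_ : #|R| + #|N :\: R| <= _); last exact: leq_add.
  by rewrite -cardsUI; apply: leq_trans (leq_addr _ _); apply: subset_leq_card;
     apply/fintype.subsetP => b bN; rewrite !inE bN andbT orbN.
- have succF b : b \in R -> b != a -> b \notin a |: F.
    by move=> bR ba; rewrite !inE negb_or ba; apply: contraL bR => /FR.
  move=> b; rewrite !inE => /predU1P[->|bF].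
    by rewrite -!in_setU1 !succF ?fN ?gN ?inE ?eqxx ?orbT.
  have /andP[/negPf-> /negPf->] := indF b bF.
  have := FR b bF; rewrite !inE !negb_or.
  have -> : b \in N by apply/sub/(fintype.subsetP FN).
  by move=> /and5P[_ _ _ -> ->].
Qed.

End Codes.

(** * Irreducible elements *)

Section Irreducibles.
Variables (T : finType) (mul : T -> T -> T).
Local Notation "x ** y" := (mul x y) (at level 40, left associativity).

Definition irreducibles : {set T} :=
  [set a | [forall x, forall y, (x ** y == a) ==> (x == a) || (y == a)]].

Lemma mul_irreducible a x y : a \in irreducibles -> x ** y = a -> x = a \/ y = a.
Proof.
rewrite inE => /forallP/(_ x)/forallP/(_ y)/implyP + /eqP xy.
by move=> /(_ xy)/orP[] /eqP; [left|right].
Qed.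

Lemma reducibleP a : a \notin irreducibles -> exists x y, [/\ x ** y = a, x != a & y != a].
Proof.
rewrite inE => /forallPn[x /forallPn[y]]; rewrite negb_imply negb_or.
by move=> /and3P[/eqP xy xa ya]; exists x, y.
Qed.

(** Regularity in the sense of von Neumann, with the idempotent ay reducible; column a then factors
    through ay. *)
Definition right_regular : {set T} :=
  [set a in irreducibles | [exists y, (a ** y \notin irreducibles) && (a ** y ** a == a)]].

Definition left_regular : {set T} :=
  [set a in irreducibles | [exists y, (y ** a \notin irreducibles) && (a ** (y ** a) == a)]].

Hypothesis mulA : associative mul.

Variables (a b : T).
Hypotheses (Pa : a \in irreducibles) (Pb : b \in irreducibles) (neq_ab : a != b).
Hypotheses (Ra : a \notin right_regular) (Lb : b \notin left_regular).
Hypotheses (Tab : a ** b \notin irreducibles) (Tba : b ** a \notin irreducibles).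

Local Notation val := (word_eval mul a b).
Local Notation P := irreducibles.

Lemma val_cons h c s : val h (c :: s) = (if h then a else b) ** val c s.
Proof. by []. Qed.

Lemma val_rcons h s c : val h (rcons s c) = val h s ** (if c then a else b).
Proof. by rewrite -cats1 word_eval_cat. Qed.

Lemma val_irreducible h s : val h s \in P -> val h s = a \/ val h s = b.
Proof.
elim: s h => [|c s IH] h; first by case: h; [left|right].
rewrite val_cons => Pv; have [E|E] := mul_irreducible Pv erefl.
  by rewrite -{}E; case: (h); [left|right].
by rewrite -E; apply: IH; rewrite E.
Qed.

(** Letters are stripped from both ends. An end b would give ba = a or ab = a, though ba and ab are
    reducible, and a = (aw)a with aw reducible is excluded by [Ra]. *)
Lemma a_power h s : val h s = a -> h && all id s.
Proof.
have [m] := ubnP (size s); elim: m h s => // m IH h s /ltnSE-sm.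
case: s sm => [|c s] sm; first by case: h => // /eqP; rewrite eq_sym (negPf neq_ab).
have sm' : size s < m by [].
rewrite val_cons; case: h => v; last first.
  have [E|E] := mul_irreducible Pa v; first by move: neq_ab; rewrite E eqxx.
  by move: Tba; rewrite -[in b ** a]E v Pa.
have [E|nE] := eqVneq (val c s) a; first by have := IH c s sm' E.
have {}v : val true (c :: s) = a by [].
move: v sm; case/lastP: (c :: s) => // {sm' nE} {}s {}c.
rewrite val_rcons size_rcons all_rcons => v sm; case: c v => v; last first.
  have [E|E] := mul_irreducible Pa v; last by move: neq_ab; rewrite E eqxx.
  by move: Tab; rewrite -[in a ** b]E v Pa.
have [E|nE] := eqVneq (val true s) a; first by have := IH true s sm E.
have [Pe|Te] := boolP (val true s \in P).
  have [E|E] := val_irreducible Pe; first by rewrite E eqxx in nE.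
  by move: Tba; rewrite -[in b ** a]E v Pa.
case: s v nE Te {sm} => [|c s] v nE Te; first by rewrite eqxx in nE.
rewrite val_cons in v Te; case/negP: Ra; rewrite inE Pa; apply/existsP.
by exists (val c s); rewrite Te v eqxx.
Qed.

Lemma b_power h s : val h s = b -> ~~ h && all negb s.
Proof.
have [m] := ubnP (size s); elim: m h s => // m IH h s /ltnSE-sm.
case: s sm => [|c s] sm; first by case: h => // /eqP; rewrite (negPf neq_ab).
have sm' : size s < m by [].
rewrite val_cons; case: h => v.
  have [E|E] := mul_irreducible Pb v; first by move: neq_ab; rewrite E eqxx.
  by move: Tab; rewrite -[in a ** b]E v Pb.
have [E|nE] := eqVneq (val c s) b; first by have := IH c s sm' E.
have [Pe|Te] := boolP (val c s \in P).
  have [E|E] := val_irreducible Pe; last by rewrite E eqxx in nE.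
  by move: Tba; rewrite -[in b ** a]E v Pb.
case/negP: Lb; rewrite inE Pb; apply/existsP.
move: v nE Te {sm sm'}; case/lastP: s => [|s d] v nE Te.
  by case: c v nE Te => v; rewrite /word_eval /= ?eqxx // Pa.
move: v Te; rewrite val_rcons; case: d {nE} => v Te; last first.
  by exists (val c s); rewrite Te v eqxx.
rewrite mulA in v; have [E|E] := mul_irreducible Pb v; last by move: neq_ab; rewrite E eqxx.
by move: Tba; rewrite -[in b ** a]E v Pb.
Qed.

Lemma mixed_reducible h s : (h || has id s) -> (~~ h || has negb s) -> val h s \notin P.
Proof.
move=> hX hY; apply/negP => /val_irreducible[/a_power|/b_power] /andP[hh].
  by move: hY; rewrite hh /= => /hasP[x xs /negP xn] /allP/(_ x xs).
by move: hX; rewrite (negPf hh) /= => /hasP[x xs xn] /allP/(_ x xs)/negP.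
Qed.

Lemma power_reducible k : a ** a != a -> pow mul a k.+1 \notin P.
Proof.
move=> aa; elim: k => [|k IH]; apply/negP; rewrite -(word_eval_nseq mul a b true) => /[dup] Pv.
  by move=> /val_irreducible[/eqP|/b_power//]; rewrite word_eval_nseq (negPf aa).
move=> /val_irreducible[|/b_power//]; rewrite word_eval_nseq -powSr // => E.
case/negP: Ra; rewrite inE Pa; apply/existsP; exists (pow mul a k).
by rewrite [a ** _]powS IH E eqxx.
Qed.

Lemma power_reducible_b k : b ** b != b -> pow mul b k.+1 \notin P.
Proof.
move=> bb; elim: k => [|k IH]; apply/negP; rewrite -(word_eval_nseq mul a b false) => /[dup] Pv.
  by move=> /val_irreducible[/a_power//|/eqP]; rewrite word_eval_nseq (negPf bb).
move=> /val_irreducible[/a_power//|]; rewrite word_eval_nseq -powS // => E.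
case/negP: Lb; rewrite inE Pb; apply/existsP; exists (pow mul b k).
by rewrite powSr // IH E eqxx.
Qed.

End Irreducibles.

Lemma pow_word (T : finType) (mul : T -> T -> T) (x y : T) c u k : associative mul ->
  word_eval mul x y c (u ++ flatten (nseq k (c :: u))) = pow mul (word_eval mul x y c u) k.
Proof.
move=> mulA; elim: k => [|k IH]; first by rewrite cats0.
by rewrite word_eval_cat // IH.
Qed.

(** * Recovering ab from ba *)

Section Agreement.
Variables (T : finType) (mul1 mul2 : T -> T -> T).
Hypotheses (mul1A : associative mul1) (mul2A : associative mul2).
Local Notation P := (irreducibles mul1).
Variables a b : T.
Hypothesis agree : forall x y, ~~ ((x \in P) && (y \in P)) -> mul1 x y = mul2 x y.
Hypotheses (Pa : a \in P) (Pb : b \in P) (neq_ab : a != b).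
Hypotheses (aaE : mul1 a a = mul2 a a) (bbE : mul1 b b = mul2 b b).
Hypothesis baE : mul1 b a = mul2 b a.
Hypotheses (Ra1 : a \notin right_regular mul1) (Lb1 : b \notin left_regular mul1).
Hypotheses (Tab1 : mul1 a b \notin P) (Tba : mul1 b a \notin P).

Local Notation val1 := (word_eval mul1 a b).
Local Notation val2 := (word_eval mul2 a b).

(* A word with a factor ba can be evaluated outwards from this factor, always
   multiplying by a reducible element, hence without using the product ab. *)
Lemma agree_ba h u v : val1 h (u ++ false :: true :: v) = val2 h (u ++ false :: true :: v).
Proof.
have mix g s : (g || has id s) -> (~~ g || has negb s) -> val1 g s \notin P.
  by move=> *; apply: mixed_reducible.
have base : val1 false (true :: v) = val2 false (true :: v).
  elim/last_ind: v => [|v y IH]; first exact: baE.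
  rewrite -rcons_cons !val_rcons // -IH; apply: agree.
  by rewrite (negPf (mix _ _ _ _)).
elim: u h => [|c u IH] h.
  by rewrite [LHS]val_cons [RHS]val_cons -base agree // (negPf (mix _ _ _ _)) ?andbF.
rewrite [LHS]val_cons [RHS]val_cons -IH agree // (negPf (mix _ _ _ _)) ?andbF //.
  by rewrite has_cat /= !orbT.
by rewrite has_cat /= !orbT.
Qed.

(** An irreducible power of a equals a, so the next product is aa, which is known; otherwise the
    next product has a reducible factor. *)
Lemma agree_pow_a k : pow mul1 a k = pow mul2 a k.
Proof.
elim: k => // k IH; rewrite -!powS // -IH.
have [Pk|Tk] := boolP (pow mul1 a k \in P); last by rewrite agree // (negPf Tk) andbF.
rewrite -(word_eval_nseq mul1 a b true) in Pk *.
have [->//|E] := val_irreducible Pk.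
by have := b_power mul1A Pa Pb neq_ab Lb1 Tab1 Tba E.
Qed.

Lemma agree_pow_b k : pow mul1 b k = pow mul2 b k.
Proof.
elim: k => // k IH; rewrite -!powS // -IH.
have [Pk|Tk] := boolP (pow mul1 b k \in P); last by rewrite agree // (negPf Tk) andbF.
rewrite -(word_eval_nseq mul1 a b false) in Pk *.
have [E|->//] := val_irreducible Pk.
by have := a_power mul1A Pa neq_ab Ra1 Tab1 Tba E.
Qed.

(** The exponent is at least two, so the word (ab)^(k+2) has a factor ba. *)
Lemma product_pow k : mul1 a b = pow mul1 (mul1 a b) k.+1 ->
  mul2 a b = pow mul2 (mul2 a b) k.+1 -> mul1 a b = mul2 a b.
Proof.
move=> -> ->.
by rewrite -!(@pow_word _ _ a b true [:: false]) //; exact: (@agree_ba true [::]).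
Qed.

(** The first two canonical words lack the factor ba. If a and b are idempotent, these laws make ab
    a higher power of itself; if neither is, the power of a or b in the word is reducible, so its
    products are known. The other words are evaluated directly. *)
Lemma law_determines w : w \in canonical_words #|T| ->
  (forall x y, mul1 x y = word_eval mul1 x y w.1 w.2) ->
  (forall x y, mul2 x y = word_eval mul2 x y w.1 w.2) ->
  (mul1 a a == a) = (mul1 b b == b) -> mul1 a b = mul2 a b.
Proof.
move=> wW law1 law2 idem.
have val12 : val1 w.1 w.2 = val2 w.1 w.2 -> mul1 a b = mul2 a b by rewrite law1 law2.
have k0 : 0 < omega #|T| by apply: leq_ltn_trans (omega_gt _).
have dup c k : nseq k.+1 c = nseq k c ++ [:: c] by rewrite -[in LHS]addn1 nseqD.
move: wW law1 law2 val12; case/predU1P => [->|wW] law1 law2 val12.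
  have law1' x y : mul1 x y = mul1 (pow mul1 x (omega #|T|).+1) y.
    by rewrite {1}law1 word_eval_cat // word_eval_nseq.
  have law2' x y : mul2 x y = mul2 (pow mul2 x (omega #|T|).+1) y.
    by rewrite {1}law2 word_eval_cat // word_eval_nseq.
  have [aa|aa] := eqVneq (mul1 a a) a.
    rewrite aa eqxx in idem; have bb := eqP (esym idem).
    (* As bb = b, the law at (ab, b) reads ab = (ab)^(N+1). *)
    apply: (@product_pow (omega #|T|)).
      have := law1' (mul1 a b) b; rewrite -mul1A bb => {1}->.
      by rewrite -powSr // -!mul1A bb.
    have bb2 : mul2 b b = b by rewrite -bbE.
    have := law2' (mul2 a b) b; rewrite -mul2A bb2 => {1}->.
    by rewrite -powSr // -!mul2A bb2.
  rewrite law1' [RHS]law2' -agree_pow_a agree //; apply/nandP; left.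
  by apply: (@power_reducible _ mul1 mul1A a b).
move: wW law1 law2 val12; case/predU1P => [->|wW] law1 law2 val12.
  have law1' x y : mul1 x y = mul1 x (pow mul1 y (omega #|T|).+1).
    by rewrite {1}law1 -[nseq _ _]/([::] ++ false :: nseq (omega #|T|).+1 false) word_eval_cat // word_eval_nseq.
  have law2' x y : mul2 x y = mul2 x (pow mul2 y (omega #|T|).+1).
    by rewrite {1}law2 -[nseq _ _]/([::] ++ false :: nseq (omega #|T|).+1 false) word_eval_cat // word_eval_nseq.
  have [aa|aa] := eqVneq (mul1 a a) a.
    apply: (@product_pow (omega #|T|)).
      by have := law1' a (mul1 a b); rewrite mul1A aa => {1}->; rewrite -powS !mul1A aa.
    have aa2 : mul2 a a = a by rewrite -aaE.
    by have := law2' a (mul2 a b); rewrite mul2A aa2 => {1}->; rewrite -powS !mul2A aa2.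
  have bb : mul1 b b != b by rewrite -idem (negPf aa).
  rewrite law1' [RHS]law2' -agree_pow_b agree //; apply/nandP; right.
  by apply: (@power_reducible_b _ mul1 mul1A a b).
apply: val12; move: wW {law1 law2}.
(* The words x, y, xx, yy and yx have known values; the last three have a factor yx. *)
do 5![case/predU1P => [->|] //]; case/predU1P => [->|].
- rewrite /=; case: (omega _) k0 => // k _; rewrite dup -catA; exact: agree_ba.
case/predU1P => [->|].
- exact: (@agree_ba true [::]).
case/predU1P => // ->.
pose Z := nseq (omega #|T|).+1 false ++ nseq (omega #|T|).+1 true.
have := @agree_ba true (nseq (omega #|T|) false)
  (nseq (omega #|T|) true ++ flatten (nseq (omega #|T|) Z) ++ [:: false]).
suff -> : nseq (omega #|T|) false ++ [:: false, true & nseq (omega #|T|) true ++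
  flatten (nseq (omega #|T|) Z) ++ [:: false]] = flatten (nseq (omega #|T|).+1 Z) ++ [:: false] by [].
by rewrite [flatten (nseq _.+1 _)]/(Z ++ flatten (nseq (omega #|T|) Z)) {2}/Z dup -!catA.
Qed.

End Agreement.

(** * Counting *)

Lemma card_sets (T : finType) : #|{set T}| = 2 ^ #|T|.
Proof.
rewrite -[in RHS]cardsT -card_powerset -cardsT; apply: eq_card => A.
by rewrite powersetE finset.subsetT inE.
Qed.

Section Classes.
Variables (n : nat) (y0 : 'I_n).
Local Notation mul := binop_mul.
Local Notation P op := (irreducibles (mul op)).
Implicit Types op : binop n.

(** Write each reducible a as xy with x, y distinct from a. By [independent_fifth], at least u such
    a form a set F whose factors x, y lie outside F; row a is then recovered from rows x and y by az
    = x(yz). *)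
Lemma card_many_reducible (u : nat) :
  #|[set op : binop n | `[< associative (mul op) >] && (5 * u <= #|~: P op|)]|
    <= 2 ^ n * n ^ (n * (n - u)).
Proof.
pose good op (F : {set 'I_n}) := (u <= #|F|) &&
  [forall a in F, exists x, exists y, [&& x \notin F, y \notin F & mul op x y == a]].
pose code op := odflt finset.set0 [pick F | good op F].
pose K (F : {set 'I_n}) : {set 'I_n * 'I_n} := finset.setX (~: F) [set: 'I_n]%SET.
have codeP op : associative (mul op) -> 5 * u <= #|~: P op| -> good op (code op).
  move=> opA big; rewrite /code; case: pickP => // none.
  have red a : exists p : 'I_n * 'I_n, a \in ~: P op -> [/\ mul op p.1 p.2 = a, p.1 != a & p.2 != a].
    have [aT|aT] := boolP (a \in ~: P op); last by exists (a, a).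
    have [x [y xy]] := reducibleP (a := a) (mul := mul op) (etrans (esym (finset.in_setC _ _)) aT).
    by exists (x, y).
  have [f fP] := choice red.
  have [||F [FT TF Find]] := @independent_fifth _ (fst \o f) (snd \o f) (~: P op).
  - by move=> a /fP[].
  - by move=> a /fP[].
  have := none F; rewrite /good -(leq_pmul2l (m := 5)) // (leq_trans big TF) /=.
  move=> /negbT/forall_inPn[a aF]; case/negP.
  have /andP[xF yF] := Find a aF; have [xy _ _] := fP a (fintype.subsetP FT a aF).
  by apply/existsP; exists (f a).1; apply/existsP; exists (f a).2; rewrite xF yF xy /=.
have := @card_code _ _ _ y0 [set op : binop n | `[< associative (mul op) >] && (5 * u <= #|~: P op|)] code K (n * (n - u)).
rewrite card_sets card_ord; apply=> [op|op op'].
  rewrite inE => /andP[/asboolP opA big]; have /andP[uF _] := codeP op opA big.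
  rewrite cardsX cardsT cardsCs finset.setCK card_ord mulnC leq_mul2l leq_sub2l ?orbT //.
rewrite !inE => /andP[/asboolP opA big] /andP[/asboolP opA' _] cE agree.
have /andP[_ /forall_inP F] := codeP op opA big.
have row x y : x \notin code op -> mul op x y = mul op' x y.
  by move=> xF; apply: agree; rewrite !inE xF.
apply/ffunP => -[a z]; have [aF|aF] := boolP (a \in code op); last exact: row.
have /existsP[x /existsP[y /and3P[xF yF /eqP xy]]] := F a aF.
rewrite -[op _]/(mul op a z) -[op' _]/(mul op' a z).
by rewrite -xy -opA (row y) // (row x) // opA' (row x y).
Qed.

(** An irreducible product is one of its factors, so these two bits determine it. *)
Definition product_type op : {ffun 'I_n * 'I_n -> bool * bool} :=
  [ffun p => (mul op p.1 p.2 \in P op, mul op p.1 p.2 == p.1)].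

Lemma product_type_eq op op' x y : P op = P op' -> product_type op = product_type op' ->
  x \in P op -> y \in P op -> mul op x y \in P op -> mul op x y = mul op' x y.
Proof.
move=> PE tE xP yP xyP.
have /(congr1 (fun f : {ffun _ -> _} => f (x, y))) := tE; rewrite !ffunE /= xyP => -[xyP' E].
have [xyE|xyE] := mul_irreducible xyP erefl.
  by move: E; rewrite -xyE eqxx => /esym/eqP ->.
have [xyE'|xyE'] := @mul_irreducible _ _ _ _ _ (esym xyP') erefl; last by rewrite -xyE.
by move: E; rewrite -xyE' eqxx => /eqP ->.
Qed.

Lemma product_type_irr op op' x y : P op = P op' -> product_type op = product_type op' ->
  (mul op x y \in P op) = (mul op' x y \in P op).
Proof.
move=> PE tE; have /(congr1 (fun f : {ffun _ -> _} => f (x, y))) := tE.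
by rewrite !ffunE /= PE => -[->].
Qed.

Definition cross_cells (Q : {set 'I_n}) : {set 'I_n * 'I_n} :=
  [set p | ~~ ((p.1 \in Q) && (p.2 \in Q))]%SET.

Lemma card_cross_cells (Q : {set 'I_n}) m : #|~: Q| <= m -> #|cross_cells Q| <= 2 * m * n.
Proof.
move=> Qm; apply: (@leq_trans #|finset.setX (~: Q) [set: 'I_n]%SET :|: finset.setX [set: 'I_n]%SET (~: Q)|).
  by apply/subset_leq_card/fintype.subsetP => -[x y]; rewrite !inE /= andbT negb_and.
apply: leq_trans (leq_card_setU _ _) _; rewrite !cardsX cardsT card_ord.
by rewrite [n * _]mulnC addnn -mul2n -mulnA !leq_mul2l leq_mul2r Qm !orbT.
Qed.

Lemma card_many_right_regular (m q : nat) :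
  #|[set op : binop n | [&& `[< associative (mul op) >], #|~: P op| <= m &
      q <= #|right_regular (mul op)|]]|
    <= #|{: {set 'I_n} * {set 'I_n} * {ffun 'I_n -> 'I_n * 'I_n} *
          {ffun 'I_n * 'I_n -> bool * bool}}| * n ^ (2 * m * n + n * (n - q) + 2 * n).
Proof.
pose R op := right_regular (mul op).
pose inverse op := [ffun a => odflt (a, a) [pick p : 'I_n * 'I_n |
  [&& mul op a p.1 == p.2, p.2 \notin P op & mul op p.2 a == a]]].
pose code op := (P op, R op, inverse op, product_type op).
pose K (c : {set 'I_n} * {set 'I_n} * {ffun 'I_n -> 'I_n * 'I_n} *
    {ffun 'I_n * 'I_n -> bool * bool}) : {set 'I_n * 'I_n} :=
  let: (Q, Z, v, _) := c in cross_cells Q :|: finset.setX [set: 'I_n]%SET (~: Z)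
     :|: ([set ((v a).1, a) | a : 'I_n]%SET :|: [set (a, a) | a : 'I_n]%SET).
have inverseP op a : a \in R op -> [/\ mul op a (inverse op a).1 = (inverse op a).2,
    (inverse op a).2 \notin P op & mul op (inverse op a).2 a = a].
  rewrite /R inE => /andP[aP /existsP[y /andP[yP /eqP yE]]]; rewrite ffunE.
  case: pickP => [p /and3P[/eqP ? ? /eqP ?]//|/(_ (y, mul op a y))].
  by rewrite /= eqxx yP yE eqxx.
have := @card_code _ _ _ y0 [set op : binop n | [&& `[< associative (mul op) >],
  #|~: P op| <= m & q <= #|R op|]] code K (2 * m * n + n * (n - q) + 2 * n).
rewrite card_ord; apply=> [op|op op'].
  rewrite inE => /and3P[_ Pm qR] /=.
  apply: leq_trans (leq_card_setU _ _) _; apply: leq_add.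
    apply: leq_trans (leq_card_setU _ _) _; apply: leq_add; first exact: card_cross_cells.
    by rewrite cardsX cardsT card_ord leq_mul2l cardsCs finset.setCK card_ord leq_sub2l ?orbT.
  apply: leq_trans (leq_card_setU _ _) _; rewrite mul2n -addnn.
  by apply: leq_add; apply: leq_trans (leq_imset_card _ _) _; rewrite card_ord.
rewrite !inE => /and3P[/asboolP opA _ _] /and3P[/asboolP opA' _ _] [PE RE vE tE] agree.
have agreeT x y : ~~ ((x \in P op) && (y \in P op)) -> mul op x y = mul op' x y.
  move=> xyT; apply: agree; rewrite !finset.in_setU. by rewrite [_ \in cross_cells _]inE xyT.
apply/ffunP => -[z a].
have [/agree//|] := boolP ((z, a) \in K (code op)).
rewrite !finset.in_setU [_ \in cross_cells _]inE !negb_or negbK /= => /andP[/andP[/andP[zP aP] aR] /andP[zv za]].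
have {}aR : a \in R op by move: aR; rewrite !inE /= negbK.
have [zaP|zaT] := boolP (mul op z a \in P op); first exact: product_type_eq.
have zaT' : mul op' z a \notin P op by rewrite -(product_type_irr z a PE tE).
have [v1 v2 v3] := inverseP op a aR.
have [] := inverseP op' a; [by rewrite -RE|rewrite -vE => v1' _ v3'].
set y := (inverse op a).1 in v1 v1' *; set e := (inverse op a).2 in v1 v2 v3 v1' v3' *.
rewrite -[op _]/(mul op z a) -[op' _]/(mul op' z a).
have -> : mul op z a = mul op (mul op z e) a by rewrite -opA v3.
have -> : mul op' z a = mul op' (mul op' z e) a by rewrite -opA' v3'.
have zeE : mul op z e = mul op' z e by rewrite agreeT // (negPf v2) andbF.
(* If ze is reducible, (ze)a is a known cell. Otherwise ze = z, as e is reducible, so (za)y = z with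
   za reducible; this forces y = z, and the cell (y, a) is recorded. *)
have [zeP|zeT] := boolP (mul op z e \in P op); last by rewrite -zeE agreeT // (negPf zeT).
have [ze|ze] := mul_irreducible zeP erefl; last by rewrite -ze (negPf v2) in zeP.
have : mul op (mul op z a) y = z by rewrite -opA v1 -ze.
case/(mul_irreducible zP) => E; first by rewrite E zP in zaT.
by case/imsetP: zv; exists a => //; rewrite -/y E.
Qed.

Lemma irreducibles_flip (T : finType) (f : T -> T -> T) :
  irreducibles (fun x y => f y x) = irreducibles f.
Proof.
apply/setP => a; rewrite !inE; apply/forallP/forallP => F x; apply/forallP => y;
have /forallP/(_ x) := F y; rewrite orbC; exact.
Qed.

Lemma right_regular_flip (T : finType) (f : T -> T -> T) :
  right_regular (fun x y => f y x) = left_regular f.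
Proof. by rewrite /right_regular irreducibles_flip. Qed.

Lemma card_many_left_regular (m q : nat) :
  #|[set op : binop n | [&& `[< associative (mul op) >], #|~: P op| <= m &
      q <= #|left_regular (mul op)|]]|
    <= #|{: {set 'I_n} * {set 'I_n} * {ffun 'I_n -> 'I_n * 'I_n} *
          {ffun 'I_n * 'I_n -> bool * bool}}| * n ^ (2 * m * n + n * (n - q) + 2 * n).
Proof.
apply: leq_trans (card_many_right_regular m q).
pose flip op : binop n := [ffun p => op (p.2, p.1)].
have flipE op : mul (flip op) = fun x y => mul op y x.
  by apply/funext => x; apply/funext => y; rewrite /binop_mul ffunE.
have inj : injective flip.
  move=> f g /(congr1 flip) fg; apply/ffunP => -[x y].
  by have /(congr1 (fun h : binop n => h (x, y))) := fg; rewrite !ffunE.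
rewrite -(card_imset _ inj); apply/subset_leq_card/fintype.subsetP => _ /imsetP[op + ->].
rewrite !inE flipE irreducibles_flip right_regular_flip => /and3P[/asboolP opA -> ->].
by rewrite !andbT; apply/asboolP => x y z; rewrite opA.
Qed.

(** A rectangle of value t is named by a column chosen from its column set, hence by the same column
    from each of its rows; [coblock] reads this name from a column. *)
Definition block (f : 'I_n -> 'I_n -> 'I_n) (t x : 'I_n) := [pick y | f x y == t].

Definition coblock (f : 'I_n -> 'I_n -> 'I_n) (t y : 'I_n) :=
  if [pick x | f x y == t] is Some x then block f t x else None.

(* Without elbows, the cells of value t form rectangles with disjoint sides. *)
Lemma blockP (f : 'I_n -> 'I_n -> 'I_n) t x y : ~ has_elbow f ->
  f x y = t <-> (block f t x != None) && (block f t x == coblock f t y).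
Proof.
move=> noelbow.
have elbow a a' b b' : f a b' = f a b -> f a' b = f a b -> f a' b' = f a b.
  by move=> E1 E2; apply: contrapT => E3; apply: noelbow; exists a, a', b, b'.
rewrite /coblock; split=> [xy|].
  case: pickP => [x' /eqP x'y|/(_ x)]; last by rewrite xy eqxx.
  have -> : block f t x = block f t x'.
    apply: eq_pick => z; apply/eqP/eqP => zE.
      by rewrite (elbow x x' y z) // ?xy ?x'y.
    by rewrite (elbow x' x y z) // ?xy ?x'y.
  rewrite eqxx andbT /block; case: pickP => // /(_ y); by rewrite x'y eqxx.
case: pickP => [x' /eqP x'y|_]; last by case: (block f t x).
rewrite /block; case: pickP => // z /eqP xz /= /eqP.
case: pickP => // z' /eqP x'z [zz']; rewrite -zz' in x'z.
by rewrite (elbow x' x z y) // ?x'z ?xz ?x'y.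
Qed.

Lemma card_elbow_free (m : nat) :
  #|[set op : binop n | [&& `[< associative (mul op) >], #|~: P op| <= m &
      `[< ~ has_elbow (mul op) >]]]|
    <= #|{: {set 'I_n} * {ffun 'I_m * 'I_n -> option 'I_n} *
          {ffun 'I_m * 'I_n -> option 'I_n} *
          {ffun 'I_n * 'I_n -> bool * bool}}| * n ^ (2 * m * n).
Proof.
(* An enumeration of the reducible elements; the default x is never reached at the index of a
   reducible product. *)
pose t op (i : 'I_m) x := nth x (enum (~: P op)) i.
pose code op := (P op, [ffun p => block (mul op) (t op p.1 p.2) p.2],
  [ffun p => coblock (mul op) (t op p.1 p.2) p.2], product_type op).
pose K (c : {set 'I_n} * {ffun 'I_m * 'I_n -> option 'I_n} *
    {ffun 'I_m * 'I_n -> option 'I_n} * {ffun 'I_n * 'I_n -> bool * bool}) :=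
  cross_cells c.1.1.1.
have := @card_code _ _ _ y0 [set op : binop n | [&& `[< associative (mul op) >],
  #|~: P op| <= m & `[< ~ has_elbow (mul op) >]]] code K (2 * m * n).
rewrite card_ord; apply=> [op|op op'].
  by rewrite inE => /and3P[_ Pm _]; exact: card_cross_cells.
rewrite !inE => /and3P[_ Pm /asboolP eo] /and3P[_ _ /asboolP eo'] [PE bE cE tE] agree.
apply/ffunP => -[x y].
have [/agree//|] := boolP ((x, y) \in cross_cells (P op)).
rewrite inE negbK /= => /andP[xP yP].
have [xyP|xyT] := boolP (mul op x y \in P op); first exact: product_type_eq.
have iT : mul op x y \in enum (~: P op) by rewrite mem_enum inE.
have im : index (mul op x y) (enum (~: P op)) < m.
  by apply: leq_trans Pm; rewrite cardE index_mem.
have tE' z : t op (Ordinal im) z = mul op x y by rewrite /t nth_index.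
have tE'' z : t op' (Ordinal im) z = mul op x y by rewrite /t -PE nth_index.
have := (blockP (mul op x y) x y eo).1 erefl.
have /(congr1 (fun f : {ffun 'I_m * 'I_n -> _} => f (Ordinal im, x))) := bE.
have /(congr1 (fun f : {ffun 'I_m * 'I_n -> _} => f (Ordinal im, y))) := cE.
rewrite !ffunE /= !tE' !tE'' => -> -> /(blockP (mul op x y) x y eo').
by [].
Qed.

Definition law op (w : bool * seq bool) :=
  forall x y, mul op x y = word_eval (mul op) x y w.1 w.2.

Definition generic op := P op :\: (right_regular (mul op) :|: left_regular (mul op)).

(* Of two mirror cells (a, b) and (b, a) only one is needed: the first if a < b
   and ab is reducible, the second if ab is irreducible, since the type of ab
   then determines ab. *)
Lemma card_lawful (w : bool * seq bool) (m z v : nat) : w \in canonical_words n ->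
  2 * v + n <= z * z ->
  #|[set op : binop n | [&& `[< associative (mul op) >], #|~: P op| <= m,
      2 * z <= #|generic op| & `[< law op w >]]]|
    <= #|{: {set 'I_n} * {set 'I_n} * {ffun 'I_n * 'I_n -> bool * bool}}|
       * n ^ (2 * m * n + (n * n - v)).
Proof.
move=> wW vz.
pose Zi op := [set a in generic op | mul op a a == a]%SET.
pose Zn op := [set a in generic op | mul op a a != a]%SET.
(* Idempotent and non-idempotent elements are kept apart, as [law_determines] needs; one class has
   at least z elements. *)
pose Z op := if z <= #|Zi op| then Zi op else Zn op.
pose code op := (P op, Z op, product_type op).
pose U (c : {set 'I_n} * {set 'I_n} * {ffun 'I_n * 'I_n -> bool * bool}) :=
  [set p : 'I_n * 'I_n | [&& p.1 \in c.1.2, p.2 \in c.1.2, p.1 != p.2 &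
    if p.1 < p.2 then (c.2 p).1 else ~~ (c.2 (p.2, p.1)).1]]%SET.
pose K (c : {set 'I_n} * {set 'I_n} * {ffun 'I_n * 'I_n -> bool * bool}) :=
  cross_cells c.1.1 :|: ~: U c.
have := @card_code _ _ _ y0 [set op : binop n | [&& `[< associative (mul op) >],
  #|~: P op| <= m, 2 * z <= #|generic op| & `[< law op w >]]] code K (2 * m * n + (n * n - v)).
rewrite card_ord; apply=> [op|op op'].
  rewrite inE => /and4P[_ Pm zS _].
  apply: leq_trans (leq_card_setU _ _) _; apply: leq_add; first exact: card_cross_cells.
  rewrite cardsCs finset.setCK card_prod card_ord leq_sub2l //.
  have zZ : z <= #|Z op|.
    rewrite /Z; case: ifP => // /negbT; rewrite -ltnNge => zi; rewrite -(leq_add2l z) addnn -mul2n.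
    apply: leq_trans zS _; apply: leq_trans (leq_add (ltnW zi) (leqnn _)).
    apply: leq_trans (leq_card_setU _ _); apply/subset_leq_card/fintype.subsetP => a aS.
    by rewrite finset.in_setU [a \in Zi op]finset.in_set [a \in Zn op]finset.in_set aS orbN.
  pose swap (p : 'I_n * 'I_n) := (p.2, p.1).
  (* [U], its mirror image and the diagonal cover Z x Z, whence z^2 <= 2|U| + n and v <= |U|. *)
  have cover : #|finset.setX (Z op) (Z op)| <= #|U (code op) :|: swap @: U (code op) :|: [set (a, a) | a : 'I_n]%SET|.
    apply/subset_leq_card/fintype.subsetP => -[x y]; rewrite finset.in_setX /= => /andP[xZ yZ].
    rewrite 2!finset.in_setU.
    have [<-|xy] := eqVneq x y; first by rewrite imset_f ?orbT.
    have : ((x, y) \in U (code op)) || ((y, x) \in U (code op)).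
      rewrite !inE /= xZ yZ xy eq_sym xy /=.
      have [lt|lt|E] := ltngtP x y; [exact: orbN|by rewrite orbC orbN|].
      by move/eqP: xy; case; apply: val_inj.
    move=> /orP[->//|yxU].
    have -> : (x, y) \in swap @: U (code op) by apply/imsetP; exists (y, x).
    by rewrite orbT.
  have : z * z <= 2 * #|U (code op)| + n.
    apply: leq_trans (leq_mul zZ zZ) _; rewrite -cardsX; apply: leq_trans cover _.
    apply: leq_trans (leq_card_setU _ _) _; apply: leq_add; last first.
      by apply: leq_trans (leq_imset_card _ _) _; rewrite card_ord.
    apply: leq_trans (leq_card_setU _ _) _; rewrite mul2n -addnn leq_add2l.
    exact: leq_imset_card.
  by move=> /(leq_trans vz); rewrite leq_add2r leq_mul2l.
rewrite !inE => /and4P[/asboolP opA _ _ /asboolP lawop] /and4P[/asboolP opA' _ _ /asboolP lawop'].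
move=> [PE ZE tE] agree.
have agreeT x y : ~~ ((x \in P op) && (y \in P op)) -> mul op x y = mul op' x y.
  by move=> xyT; apply: agree; rewrite finset.in_setU [_ \in cross_cells _]inE xyT.
have agreeU p : p \notin U (code op) -> op p = op' p.
  by move=> pU; apply: agree; rewrite finset.in_setU orbC finset.in_setC pU.
have genZ op1 x : x \in Z op1 -> x \in generic op1.
  by rewrite /Z; case: ifP => _; rewrite finset.in_set => /andP[].
have diag x : mul op x x = mul op' x x.
  by apply: agreeU; rewrite inE /= eqxx !andbF.
apply/ffunP => -[a b]; have [abU|/agreeU//] := boolP ((a, b) \in U (code op)).
move: (abU); rewrite inE /= !ffunE /= => /and4P[aZ bZ ab abU'].
have aS := genZ _ _ aZ; have bS := genZ _ _ bZ.
have aS' : a \in generic op' by apply: genZ; rewrite -ZE.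
have bS' : b \in generic op' by apply: genZ; rewrite -ZE.
have hom : (mul op a a == a) = (mul op b b == b).
  move: aZ bZ; rewrite /Z; case: ifP => _; rewrite !finset.in_set => /andP[_ aE] /andP[_ bE].
    by rewrite aE bE.
  by rewrite (negPf aE) (negPf bE).
move: aS bS aS' bS'; rewrite /generic !finset.in_setD !finset.in_setU !negb_or -PE.
move=> /andP[/andP[Ra La] Pa] /andP[/andP[Rb Lb] Pb] /andP[/andP[Ra' La'] _] /andP[/andP[Rb' Lb'] _].
have [abP|abT] := boolP (mul op a b \in P op); first exact: product_type_eq.
have abT' : mul op' a b \notin P op by rewrite -(product_type_irr a b PE tE).
have [lt|lt] := ltnP a b; rewrite ?lt in abU'; first by rewrite abU' in abT.
rewrite ltnNge lt /= in abU'.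
have ltba : b < a.
  by rewrite ltn_neqAle lt andbT; apply: contraNneq ab => /val_inj ->.
have baE : mul op b a = mul op' b a.
  by apply: agreeU; rewrite inE /= !ffunE /= ltba (negPf abU') !andbF.
have wW' : w \in canonical_words #|'I_n| by rewrite card_ord.
exact: (law_determines opA opA' agreeT Pa Pb ab (diag a) (diag b) baE Ra Lb abT abU' wW').
Qed.

End Classes.

(** * Growth estimates *)

Section Growth.

Lemma leq_exp2_sq n : n <= 2 ^ (n * n).
Proof.
case: n => // n; apply: leq_trans (ltnW (ltn_expl n.+1 (ltnSn 1))) _.
by rewrite leq_exp2l // leq_pmulr.
Qed.

(** As k >= n / c, the right side is at least n^e / c^e with e >= n(n - 2k) = n(u - 2k) + n(n - u).
    Since u - 2k >= u / 2 >= n / (2r), the surplus n^(n(u - 2k)) is at least B^(n^2), which absorbs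
    a, g, c and, through its factor 2, the extra n. *)
Lemma growth (a g c r n u k B : nat) : 0 < a -> 0 < g -> 0 < k -> n <= c * k -> 4 * k <= u ->
  n <= r * u -> u <= n -> B = a * 2 * g * c -> B ^ (2 * r) <= n ->
  a * (g ^ (n * n) * n ^ (n * (n - u))) * n <= k ^ ((n - k) * (n - k)).
Proof.
move=> a0 g0 k0 nck ku nu un BE Bn.
have n0 : 0 < n by apply: leq_trans un; apply: leq_trans ku; rewrite muln_gt0.
have c0 : 0 < c by move: (leq_trans n0 nck); rewrite muln_gt0 => /andP[].
have B0 : 0 < B by rewrite BE !muln_gt0 a0 g0 c0.
set e := (n - k) * (n - k).
have en : e <= n * n by rewrite leq_mul ?leq_subr.
have ne : n * (n - 2 * k) <= e by rewrite /e; nia.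
have kn : k < n by lia.
have e0 : 0 < e by rewrite muln_gt0 subn_gt0 kn.
have nn0 : 0 < n * n by rewrite muln_gt0 n0.
have ce0 : 0 < c ^ e by rewrite expn_gt0 c0.
rewrite -(leq_pmul2r ce0) -expnMn.
apply: (@leq_trans (n ^ e)); last by rewrite leq_exp2r // mulnC.
apply: (@leq_trans (n ^ (n * (n - 2 * k)))); last by rewrite leq_pexp2l.
have -> : n * (n - 2 * k) = n * (u - 2 * k) + n * (n - u).
  by rewrite -mulnDr; congr (n * _); lia.
rewrite expnD.
have BN : B ^ (n * n) <= n ^ (n * (u - 2 * k)).
  apply: (@leq_trans ((B ^ (2 * r)) ^ (n * (u - 2 * k)))).
    rewrite -expnM leq_pexp2l // mulnCA leq_mul2l; apply/orP; right.
    apply: leq_trans nu _; rewrite [2 * r]mulnC -mulnA leq_mul2l; apply/orP; right; lia.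
  by rewrite leq_exp2r // muln_gt0 n0 subn_gt0; lia.
apply: leq_trans (leq_mul BN (leqnn _)).
rewrite BE !expnMn.
have -> x y z t : a * (x * y) * z * t = a * z * x * t * y by lia.
rewrite leq_mul2r; apply/orP; right.
apply: leq_mul; last by rewrite leq_pexp2l.
rewrite leq_mul2r; apply/orP; right; apply: leq_mul; last exact: leq_exp2_sq.
by rewrite -{1}[a]expn1 leq_pexp2l.
Qed.

Lemma growth_eventually (a g c r : nat) : 0 < a -> 0 < g -> exists n0, forall n u k,
  n0 <= n -> 0 < k -> n <= c * k -> 4 * k <= u -> n <= r * u -> u <= n ->
  a * (g ^ (n * n) * n ^ (n * (n - u))) * n <= k ^ ((n - k) * (n - k)).
Proof.
move=> a0 g0; exists ((a * 2 * g * c) ^ (2 * r)) => n u k nN k0 nck ku nu un.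
exact: growth a0 g0 k0 nck ku nu un erefl nN.
Qed.

End Growth.

(* With u about n / 256, the thresholds 5u for reducible elements, 15u for regular
   ones and 109u for half of the others make every exponent at most n (n - u). *)
Section Totals.
Variables (n u : nat).
Hypotheses (u1 : 0 < u) (un : 256 * u <= n) (nu : n <= 512 * u).

Lemma n_gt0 : 0 < n. Proof. by apply: leq_trans un; rewrite muln_gt0. Qed.

Local Notation bound := (16 ^ (n * n) * n ^ (n * (n - u))).

Lemma flags_bound j : j <= 2 * (n * n) -> 2 ^ j * (2 * 2) ^ (n * n) <= 16 ^ (n * n).
Proof.
move=> jn; have -> : 16 ^ (n * n) = (2 * 2) ^ (n * n) * (2 * 2) ^ (n * n) by rewrite -expnMn.
by rewrite leq_mul2r -[X in _ <= X ^ _]/(2 ^ 2) -expnM leq_pexp2l ?orbT.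
Qed.

Lemma bound_le j d : j <= 2 * (n * n) -> d <= n * (n - u) ->
  2 ^ j * (2 * 2) ^ (n * n) * n ^ d <= bound.
Proof. by move=> jn dn; apply: leq_mul; [exact: flags_bound|rewrite leq_pexp2l ?n_gt0]. Qed.

Lemma many_reducible_bound : 2 ^ n * n ^ (n * (n - u)) <= bound.
Proof.
apply: leq_mul => //; apply: leq_trans (@flags_bound n _).
  by rewrite leq_pmulr // expn_gt0.
by rewrite mul2n -addnn; apply: leq_trans (leq_addr _ _); rewrite leq_pmulr ?n_gt0.
Qed.

Lemma many_regular_bound :
  #|{: {set 'I_n} * {set 'I_n} * {ffun 'I_n -> 'I_n * 'I_n} *
          {ffun 'I_n * 'I_n -> bool * bool}}| *
    n ^ (2 * (5 * u) * n + n * (n - 15 * u) + 2 * n) <= bound.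
Proof.
rewrite !card_prod !card_ffun !card_sets !card_prod !card_bool !card_ord.
have n1 := n_gt0.
apply: leq_trans (@bound_le (n + n) (n + n + (2 * (5 * u) * n + n * (n - 15 * u) + 2 * n)) _ _).
- rewrite !expnD [(n * n) ^ n]expnMn.
  move: (2 ^ n) ((2 * 2) ^ (n * n)) (n ^ n) (n ^ (2 * _ * n)) (n ^ (n * _)) (n ^ (2 * n)) => a b c d e f.
  by rewrite leq_eqVlt; apply/orP; left; apply/eqP; lia.
- by nia.
- have -> : n + n + (2 * (5 * u) * n + n * (n - 15 * u) + 2 * n) = n * (4 + 10 * u + (n - 15 * u)) by nia.
  by rewrite leq_mul2l; apply/orP; right; lia.
Qed.

Lemma elbow_free_bound :
  #|{: {set 'I_n} * {ffun 'I_(5 * u) * 'I_n -> option 'I_n} *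
          {ffun 'I_(5 * u) * 'I_n -> option 'I_n} *
          {ffun 'I_n * 'I_n -> bool * bool}}| * n ^ (2 * (5 * u) * n) <= bound.
Proof.
rewrite !card_prod !card_ffun !card_sets !card_prod !card_option !card_bool !card_ord.
have n1 := n_gt0.
apply: leq_trans (@bound_le (n + 2 * (5 * u * n)) (4 * (5 * u) * n) _ _).
(* An optional column has n + 1 <= 2n values. *)
- have le : n.+1 ^ (5 * u * n) <= 2 ^ (5 * u * n) * n ^ (5 * u * n).
    by rewrite -expnMn leq_exp2r; [lia|nia].
  have -> : 2 ^ (n + 2 * (5 * u * n)) = 2 ^ n * (2 ^ (5 * u * n) * 2 ^ (5 * u * n)).
    by rewrite -!expnD; congr (2 ^ _); lia.
  have -> : n ^ (4 * (5 * u) * n) = n ^ (5 * u * n) * n ^ (5 * u * n) * n ^ (2 * (5 * u) * n).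
    by rewrite -!expnD; congr (n ^ _); lia.
  move: le; move: (n.+1 ^ _) (2 ^ (5 * u * n)) (n ^ (5 * u * n)) => x y z le.
  move: (2 ^ n) ((2 * 2) ^ (n * n)) (n ^ (2 * _ * n)) => b c d.
  apply: (@leq_trans (b * (y * z) * (y * z) * c * d)); first by rewrite !leq_mul.
  by rewrite leq_eqVlt; apply/orP; left; apply/eqP; lia.
- by nia.
- have -> : 4 * (5 * u) * n = n * (20 * u) by lia.
  by rewrite leq_mul2l; apply/orP; right; lia.
Qed.

(** The 11un cells saved exceed the 10un cross cells by un. *)
Lemma lawful_bound :
  #|{: {set 'I_n} * {set 'I_n} * {ffun 'I_n * 'I_n -> bool * bool}}|
       * n ^ (2 * (5 * u) * n + (n * n - 11 * u * n)) <= bound.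
Proof.
rewrite !card_prod !card_ffun !card_sets !card_prod !card_bool !card_ord.
have n1 := n_gt0.
rewrite -expnD; apply: bound_le; first by nia.
by rewrite !mulnBr; nia.
Qed.

End Totals.

(** * Nondualisability *)

Section Nondualisability.
Local Open Scope classical_set_scope.

Lemma hom_sprod (A B : Type) (mulA : A -> A -> A) (mulB : B -> B -> B) (f : A -> B)
  (x : A) (s : seq A) : Defs.hom mulA mulB f ->
  f (sprod mulA x s) = sprod mulB (f x) [seq f y | y <- s].
Proof. by move=> hf; elim: s x => //= y s IH x; rewrite hf IH. Qed.

Definition trivial_words_only (T : Type) (mul : T -> T -> T) : Prop :=
  forall h s, (forall x y, mul x y = word_eval mul x y h s) -> h /\ s = [:: false].

(** * The algebra of points and lines and its ghost element *)

Section Ghost.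
Variables (M : finType) (mul : M -> M -> M) (a a' b b' : M).
Hypotheses (mulA : associative mul) (ab' : mul a b' = mul a b)
  (a'b : mul a' b = mul a b) (a'b' : mul a' b' <> mul a b).
Hypothesis triv : trivial_words_only mul.

Definition line : Type := (nat * nat)%type.

(** The line (s, t) joins s in L to t in R. Crossings are indexed by ordered pairs: at [Cross m m']
    only x_m and y_m' deviate from a and b, and none does unless the lines are disjoint. *)
Inductive coord :=
  | PtL of nat
  | PtR of nat
  | Cross of line & line
  | Cst of M & M.

Definition disjoint_lines (l m : line) := (l.1 != m.1) && (l.2 != m.2).

Definition genx (l : line) (i : coord) : M :=
  match i with
  | PtL s => if l.1 == s then a' else a
  | PtR t => if l.2 == t then a' else a
  | Cross m m' => if (l == m) && disjoint_lines m m' then a' else a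
  | Cst p _ => p
  end.

Definition geny (l : line) (i : coord) : M :=
  match i with
  | PtL s => if l.1 == s then b' else b
  | PtR t => if l.2 == t then b' else b
  | Cross m m' => if (l == m') && disjoint_lines m m' then b' else b
  | Cst _ q => q
  end.

Definition gen (g : bool * line) := if g.1 then genx g.2 else geny g.2.

Definition ghost (i : coord) : M := if i is Cst p q then mul p q else mul a b.

Definition pl_carrier : set (coord -> M) :=
  [set f | exists g w, f = sprod (pow_mul mul) (gen g) (map gen w)].

Lemma pl_mul_closed f g : pl_carrier f -> pl_carrier g -> pl_carrier (pow_mul mul f g).
Proof.
move=> [x [s ->]] [y [t ->]]; exists x, (s ++ y :: t).
rewrite map_cat /= sprod_cat //.
by move=> p q r; apply/funext => i; rewrite /pow_mul mulA.
Qed.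

(** The coordinates [Cst] turn a word for the ghost into a law, so the word is x_l y_m. This is a'b'
    at a common endpoint of l and m, or at their crossing. *)
Lemma ghost_notin : ~ pl_carrier ghost.
Proof.
move=> [[h l] [w gE]].
have gEi i : ghost i = sprod mul (gen (h, l) i) [seq gen g i | g <- w].
  by rewrite gE (@hom_sprod _ _ _ mul (fun f => f i)) // -map_comp.
have [|/= hT wE] := @triv h (unzip1 w).
  move=> x y; have /= -> := gEi (Cst x y).
  rewrite /word_eval -map_comp; congr sprod; first by rewrite /gen /=; case: (h).
  by apply: eq_map => -[[] m].
rewrite hT {h hT} in gE gEi; case: w wE gE gEi => [//|[[] m] [|//]] //= _ _ gEi.
have [lm1|lm1] := eqVneq l.1 m.1.
  by have /= := gEi (PtL l.1); rewrite /gen /= lm1 !eqxx => /esym.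
have [lm2|lm2] := eqVneq l.2 m.2.
  by have /= := gEi (PtR l.2); rewrite /gen /= lm2 !eqxx => /esym.
have /= := gEi (Cross l m).
by rewrite /gen /= !eqxx /disjoint_lines lm1 lm2 => /esym.
Qed.

Let A : Type := pl_carrier.

Definition plmul (f g : A) : A :=
  SigSub (mem_set (pl_mul_closed (set_valP f) (set_valP g))).

Lemma gen_in g : pl_carrier (gen g). Proof. by exists g, [::]. Qed.

Definition agen (g : bool * line) : A := SigSub (mem_set (gen_in g)).

(** By [ptLE] any two distinct lines through s give the same product; the ends 0 and 1 are a
    choice. *)
Definition ptL (s : nat) : A := plmul (agen (true, (s, 0))) (agen (false, (s, 1))).
Definition ptR (t : nat) : A := plmul (agen (true, (0, t))) (agen (false, (1, t))).

Lemma mul_off (p q : bool) : ~~ (p && q) ->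
  mul (if p then a' else a) (if q then b' else b) = mul a b.
Proof. by case: p; case: q. Qed.

Lemma cross_off (l l' : line) (m m' : line) : ~~ disjoint_lines l l' ->
  mul (genx l (Cross m m')) (geny l' (Cross m m')) = mul a b.
Proof.
move=> ll'; apply: mul_off; apply: contra ll'.
by move=> /andP[/andP[/eqP-> d] /andP[/eqP-> _]].
Qed.

Lemma ptLE s t t' : t != t' -> plmul (agen (true, (s, t))) (agen (false, (s, t'))) = ptL s.
Proof.
move=> tt'; apply: val_inj; apply/funext => i; rewrite /= /pow_mul /gen /=.
case: i => [s0|t0|m m'|p q] //; last first.
  by rewrite !cross_off // /disjoint_lines /= eqxx.
rewrite /= !mul_off //; first by case: (0 =P t0) => // <-.
by apply: contra tt' => /andP[/eqP-> /eqP->].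
Qed.

Lemma ptRE s s' t : s != s' -> plmul (agen (true, (s, t))) (agen (false, (s', t))) = ptR t.
Proof.
move=> ss'; apply: val_inj; apply/funext => i; rewrite /= /pow_mul /gen /=.
case: i => [s0|t0|m m'|p q] //; last first.
  by rewrite !cross_off // /disjoint_lines /= eqxx /= ?andbF.
rewrite /= !mul_off //; first by case: (0 =P s0) => // <-.
by apply: contra ss' => /andP[/eqP-> /eqP->].
Qed.

(** This makes the ghost the pointwise limit of the elements [ptL s]. *)
Lemma ptL_ghost s i : i <> PtL s -> val (ptL s) i = ghost i.
Proof.
rewrite /= /pow_mul /gen; case: i => [s0|t0|m m'|p q] //= si.
- by rewrite !mul_off // andbb; apply/eqP => ss0; apply: si; rewrite ss0.
- by rewrite mul_off //; case: (0 =P t0) => // <-.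
- by rewrite (@cross_off (s, 0) (s, 1)) // /disjoint_lines /= eqxx.
Qed.

Section Hom.
Variable h : A -> M.
Hypothesis hom_h : Defs.hom plmul mul h.

Let color (l : line) : M * M := (h (agen (true, l)), h (agen (false, l))).

Let N := #|{: M * M}|.

Lemma color_row s t t' : t != t' -> color (s, t) = color (s, t') ->
  h (ptL s) = mul (color (s, t)).1 (color (s, t)).2.
Proof. by move=> tt' cE; rewrite -(ptLE s tt') hom_h {2}cE. Qed.

Lemma color_col s s' t : s != s' -> color (s, t) = color (s', t) ->
  h (ptR t) = mul (color (s, t)).1 (color (s, t)).2.
Proof. by move=> tt' cE; rewrite -(ptRE t tt') hom_h {2}cE. Qed.

(* In a grid of lines with N + 1 rows, each row has at most N columns in which
   its colour is not repeated, so with enough columns there is one in which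
   every row repeats its colour; two rows agree in this column. *)
Lemma grid_meet (L R : seq nat) : uniq L -> uniq R -> N < size L ->
  size L * N < size R -> exists s t, [/\ s \in L, t \in R & h (ptL s) = h (ptR t)].
Proof.
move=> uL uR LN RN.
pose lone s t := (t \in R) && all (fun t' => (t' == t) || (color (s, t') != color (s, t))) R.
have lone_le s : count (lone s) R <= N.
  rewrite -size_filter -(size_map (fun t => color (s, t))).
  rewrite -[leqRHS]/(#|{: M * M}|) cardT.
  apply: uniq_leq_size; last by move=> x _; rewrite mem_enum.
  rewrite map_inj_in_uniq ?filter_uniq // => t t'.
  rewrite !mem_filter => /andP[/andP[tR /allP/(_ t')]] .
  move=> + _ /andP[_ t'R] cE; move=> /(_ t'R); rewrite cE eqxx orbF => /eqP //.
have [t tR tgood] : exists2 t, t \in R & all (fun s => ~~ lone s t) L.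
  apply/hasP; rewrite has_count; apply: contraLR RN; rewrite -!leqNgt leqn0 => /eqP c0.
  have : size R <= \sum_(s <- L) count (lone s) R.
    have -> : \sum_(s <- L) count (lone s) R = \sum_(t <- R) count (lone ^~ t) L.
      under eq_bigr do rewrite -sum1_count big_mkcond.
      by rewrite exchange_big /=; apply: eq_bigr => t _; rewrite -big_mkcond sum1_count.
    rewrite -sum1_size; rewrite !big_seq; apply: leq_sum => t tR.
    rewrite -has_count; apply/negP => /negP/hasPn nl.
    have : has (fun t => all (fun s => ~~ lone s t) L) R.
      by apply/hasP; exists t => //; apply/allP.
    by rewrite has_count c0.
  move=> /leq_trans; apply.
  apply: leq_trans (leq_sum _ _) _; first by move=> s _; exact: lone_le.
  by rewrite big_const_seq count_predT iter_addn_0 mulnC.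
have [s [s' [sL s'L ss' cE]]] : exists s s', [/\ s \in L, s' \in L, s != s' & color (s, t) = color (s', t)].
  apply: contrapT => nE; move: LN; rewrite ltnNge => /negP; apply.
  rewrite -(size_map (fun s => color (s, t))) [N]cardT.
  apply: uniq_leq_size; last by move=> x _; rewrite mem_enum.
  rewrite map_inj_in_uniq // => s s' sL s'L cE; apply/eqP/negP => /negP ss'.
  by apply: nE; exists s, s'; split.
exists s, t; split=> //.
have := allP tgood _ sL; rewrite /lone tR /= => /allPn[t' t'R].
rewrite negb_or negbK => /andP[t't /eqP cE'].
rewrite (@color_row s t t') // 1?eq_sym //.
by rewrite (color_col ss' cE).
Qed.

(** By pigeonhole some value v is taken on more than (N + 1)N points of R, and [grid_meet] then
    finds v among any N + 1 points of L. *)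
Lemma limit_ex : exists v, forall L, uniq L -> N < size L ->
  exists2 s, s \in L & h (ptL s) = v.
Proof.
have [v Rv] : exists v, N.+1 * N < count (fun t => h (ptR t) == v)
    (iota 0 (#|M| * (N.+1 * N)).+1).
  apply: contrapT => nE; set r := iota 0 _ in nE.
  have sr : size r = (#|M| * (N.+1 * N)).+1 by rewrite size_iota.
  suff : size r <= #|M| * (N.+1 * N) by rewrite sr ltnn.
  rewrite -sum1_size (partition_big (fun t => h (ptR t)) xpredT) //=.
  rewrite -sum_nat_const; apply: leq_sum => v _.
  by rewrite sum1_count leqNgt; apply/negP => lt; apply: nE; exists v.
exists v => L uL NL.
pose R := [seq t <- iota 0 (#|M| * (N.+1 * N)).+1 | h (ptR t) == v].
have sL : size (take N.+1 L) = N.+1 by rewrite size_takel.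
have [||||s [t [sL' tR E]]] := @grid_meet (take N.+1 L) R.
- by rewrite take_uniq.
- by rewrite filter_uniq ?iota_uniq.
- by rewrite sL.
- by rewrite sL size_filter.
exists s; first exact: mem_take sL'.
by move: tR; rewrite mem_filter E => /andP[/eqP].
Qed.

End Hom.

Let N := #|{: M * M}|.

(* More than half of the first 2N + 1 points vote for the limit. *)
Definition limit_val (h : A -> M) : M :=
  odflt (mul a b) [pick v | N < count (fun s => h (ptL s) == v) (iota 0 (2 * N).+1)].

(** At most N points miss the limit, so it wins the vote; any other winner would have more than N
    points missing the limit. *)
Lemma limit_valP h L : Defs.hom plmul mul h -> uniq L -> N < size L ->
  exists2 s, s \in L & h (ptL s) = limit_val h.
Proof.
move=> hh; have [v vP] := limit_ex hh.
have vN : N < count (fun s => h (ptL s) == v) (iota 0 (2 * N).+1).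
  rewrite ltnNge; apply/negP => cN.
  have [||s] := vP [seq s <- iota 0 (2 * N).+1 | predC (fun s => h (ptL s) == v) s].
  - by rewrite filter_uniq ?iota_uniq.
  - rewrite size_filter -(ltn_add2l N) addnn -mul2n.
    by rewrite -[X in X <= _](size_iota 0) -(count_predC (fun s => h (ptL s) == v)) leq_add2r.
  - by rewrite mem_filter => /andP[/eqP].
suff -> : limit_val h = v by exact: vP.
rewrite /limit_val; case: pickP => [v' v'N|/(_ v)]; last by rewrite vN.
have [||s] := vP [seq s <- iota 0 (2 * N).+1 | h (ptL s) == v'].
- by rewrite filter_uniq ?iota_uniq.
- by rewrite size_filter.
- by rewrite mem_filter => /andP[/eqP -> _].
Qed.

(** Each of the homomorphisms rules out at most N points. *)
Lemma limit_val_common (I : eqType) (F : I -> A -> M) (r : seq I) (L : seq nat) :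
  (forall i, Defs.hom plmul mul (F i)) -> uniq L -> size r * N < size L ->
  exists2 s, s \in L & forall i, i \in r -> F i (ptL s) = limit_val (F i).
Proof.
move=> hF; elim: r L => [|i r IH] L uL sL.
  by case: L uL sL => // s L _ _; exists s; rewrite ?mem_head.
pose good s := F i (ptL s) == limit_val (F i).
have [||s] := IH (seq.filter good L); first by rewrite filter_uniq.
  have bad : size (seq.filter (predC good) L) <= N.
    rewrite leqNgt; apply/negP => bN.
    have [|s] := limit_valP (hF i) _ bN; first by rewrite filter_uniq.
    by rewrite mem_filter => /andP[/eqP].
  rewrite -(ltn_add2r N) addnC -mulSn; apply: leq_trans sL _.
  rewrite -(count_predC good) !size_filter leq_add2l.
  by rewrite size_filter in bad.
rewrite mem_filter => /andP[/eqP gs sL'] rP.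
by exists s => // j; rewrite inE => /predU1P[->|/rP].
Qed.

Definition ghost_map (x : D mul plmul) : M := limit_val (set_val x).

Lemma D_common n (x : 'I_n -> D mul plmul) : exists p : A, forall k, set_val (x k) p = ghost_map (x k).
Proof.
have [|||s _ sP] := @limit_val_common _ (fun k => set_val (x k)) (enum 'I_n)
    (iota 0 (n * N).+1).
- by move=> k; exact: set_valP.
- exact: iota_uniq.
- by rewrite size_enum_ord size_iota.
by exists (ptL s) => k; apply: sP; rewrite mem_enum.
Qed.

Lemma D_common1 n (x : 'I_n -> D mul plmul) (y : D mul plmul) : exists2 p : A,
  (forall k, set_val (x k) p = ghost_map (x k)) & set_val y p = ghost_map y.
Proof.
have [p pP] := D_common (fun k : 'I_n.+1 => if unlift ord0 k is Some j then x j else y).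
exists p => [k|]; last by have := pP ord0; rewrite unlift_none.
by have := pP (lift ord0 k); rewrite liftK.
Qed.

(** Continuity: the vote reads finitely many coordinates. Preservation: on finitely many elements of
    D(A) the map agrees with evaluation at a single [ptL s]. *)
Lemma ghost_map_E (S : structure M) : E S ghost_map.
Proof.
split.
  move=> x U /= /(@nbhs_singleton (discrete_topology M)) xU.
  have : nbhs x [set y | forall s : 'I_(2 * N).+1, set_val y (ptL s) = set_val x (ptL s)].
    apply: (@filter_forall _ _ (fun s : 'I_(2 * N).+1 => [set y : D mul plmul | set_val y (ptL s) = set_val x (ptL s)]) (nbhs x) (nbhs_filter x)) => s.
    exact: (@eval_E M mul S _ plmul (ptL s)).1 x _ (@discrete_set1 (discrete_topology M) _).
  apply: (@filterS _ (nbhs x) (nbhs_filter x)) => y yx.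
  suff yxE : ghost_map y = ghost_map x by rewrite /= yxE.
  rewrite /ghost_map /limit_val; congr odflt; apply: eq_pick => v; congr (_ < _).
  apply: eq_in_count => s; rewrite mem_iota add0n /= => sN.
  by have /= -> := yx (Ordinal sN).
split=> [n g x y Sg gE|n g x y Sg gE|n r x Sr rE].
- have [p xp <-] := D_common1 x y; rewrite -gE; congr g.
  by apply/funext => k /=; rewrite xp.
- have [p xp <-] := D_common1 x y; rewrite -gE; congr g.
  by apply/funext => k /=; rewrite xp.
- have [p xp] := D_common x.
  suff -> : ghost_map \o x = fun k => set_val (x k) p by [].
  by apply/funext => k /=; rewrite xp.
Qed.

Lemma proj_in_D (i : coord) : D mul plmul (fun f : A => set_val f i).
Proof. by move=> f g. Qed.

Lemma not_dualisable : ~ dualisable mul.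
Proof.
move=> [S _ /(_ A plmul)[]].
  exists coord, pl_carrier, set_val; split.
  - split; first by exists (gen (true, (0, 0))); exact: gen_in.
    exact: pl_mul_closed.
  - by [].
  - split=> [f _|f g _ _|f fP]; [exact: set_valP|exact: val_inj|].
    by exists (SigSub (mem_set fP)).
move=> _ _ [_ _ /(_ _ (ghost_map_E S))[f _ fE]].
apply: ghost_notin; suff <- : set_val f = ghost by exact: set_valP.
(* The projection to i lies in D(A). Evaluation at f sends it to f i, and its limit value is ghost
   i, as the elements [ptL s] agree with the ghost at i with at most one exception. *)
apply/funext => i.
pose x : D mul plmul := SigSub (mem_set (@proj_in_D i)).
have -> : set_val f i = ghost_map x by rewrite -fE.
(* The exceptional point, if any, is removed; N + 1 points remain. *)
pose L := [seq s <- iota 0 N.+2 | if i is PtL s0 then s != s0 else true].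
have [||s] := @limit_valP (set_val x) L (set_valP x).
- by rewrite filter_uniq ?iota_uniq.
- rewrite size_filter; case: (i) => [s0|t0|m m'|p q]; last 3 first.
  + by rewrite count_predT size_iota.
  + by rewrite count_predT size_iota.
  + by rewrite count_predT size_iota.
  have := count_predC (pred1 s0) (iota 0 N.+2); rewrite size_iota.
  rewrite (count_uniq_mem _ (iota_uniq 0 N.+2)) => E.
  have : N.+2 <= 1 + count (predC (pred1 s0)) (iota 0 N.+2).
    by rewrite -[X in X <= _]E leq_add2r leq_b1.
  by [].
- rewrite /ghost_map mem_filter => /andP[si _] <-; apply: ptL_ghost.
  by move=> iE; rewrite iE eqxx in si.
Qed.
End Ghost.

Lemma dualisable_elbow_free_or_identity (M : finType) (mul : M -> M -> M) :
  associative mul -> dualisable mul -> ~ has_elbow mul \/ ~ trivial_words_only mul.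
Proof.
move=> mulA dM; apply/not_andP => -[[a [a' [b [b' [E1 E2 E3]]]]] triv].
exact: (not_dualisable mulA E1 E2 E3 triv).
Qed.

End Nondualisability.

(** * The proportion of dualisable semigroups *)

(** All products lie in [B], and a product with a factor in [B] is z, so both bracketings of three
    elements give z. *)
Lemma num_semigroups_ge (n k : nat) : 0 < k -> k <= n ->
  k ^ ((n - k) * (n - k)) <= num_semigroups n.
Proof.
rewrite /num_semigroups => k0 kn; pose z : 'I_n := widen_ord kn (Ordinal k0).
pose B : {set 'I_n} := [set widen_ord kn i | i : 'I_k]%SET.
have cB : #|B| = k by rewrite card_imset ?card_ord // => i j /(congr1 val) /= /val_inj.
have zB : z \in B by apply: imset_f.
pose X : {set 'I_n * 'I_n} := finset.setX (~: B) (~: B).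
have cX : #|X| = (n - k) * (n - k) by rewrite cardsX (cardsCs (~: B)) finset.setCK cB card_ord.
apply: (@leq_trans #|pffun_on z X B|); first by rewrite card_pffun_on cB cX.
apply/subset_leq_card/fintype.subsetP => op /pffun_onP[/supportP supp im].
have inB p : op p \in B.
  have [pX|pX] := boolP (p \in X); last by rewrite supp.
  by apply: im; apply/fintype.imageP; exists p.
have outL x y : x \in B -> binop_mul op x y = z.
  by move=> xB; apply: supp; rewrite !inE /= xB.
have outR x y : y \in B -> binop_mul op x y = z.
  by move=> yB; apply: supp; rewrite !inE /= yB andbF.
rewrite unfold_in; apply/asboolP => x y w.
have inBm u v : binop_mul op u v \in B by exact: (inB (u, v)).
by rewrite (outR x) // (outL _ w).
Qed.

Lemma num_dualisable_le (n u : nat) : 0 < u -> 256 * u <= n -> n <= 512 * u ->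
  num_dualisable_semigroups n <= 14 * (16 ^ (n * n) * n ^ (n * (n - u))).
Proof.
move=> u0 un nu; have n0 := n_gt0 u0 un.
pose y0 : 'I_n := Ordinal n0; set m := 5 * u.
(* From n <= 512u, as 22 * 512 + 512 <= 109 * 109. *)
have v_le : 2 * (11 * u * n) + n <= 109 * u * (109 * u) by nia.
pose P (op : binop n) := irreducibles (binop_mul op).
pose A (op : binop n) := `[< associative (binop_mul op) >].
pose C0 := [set op : binop n | A op && (m <= #|~: P op|)]%SET.
pose C1 := [set op : binop n | [&& A op, #|~: P op| <= m & `[< ~ has_elbow (binop_mul op) >]]]%SET.
pose C2 := [set op : binop n | [&& A op, #|~: P op| <= m & 15 * u <= #|right_regular (binop_mul op)|]]%SET.
pose C3 := [set op : binop n | [&& A op, #|~: P op| <= m & 15 * u <= #|left_regular (binop_mul op)|]]%SET.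
pose C4 w := [set op : binop n | [&& A op, #|~: P op| <= m, 2 * (109 * u) <= #|generic op| & `[< law op w >]]]%SET.
pose U4 ws := [set op : binop n | has (fun w => op \in C4 w) ws]%SET.
set b := _ * n ^ _.
have b0 : #|C0| <= b := leq_trans (card_many_reducible y0 u) (many_reducible_bound u0 un).
have b1 : #|C1| <= b := leq_trans (card_elbow_free y0 m) (elbow_free_bound u0 un nu).
have b2 : #|C2| <= b := leq_trans (card_many_right_regular y0 m (15 * u)) (many_regular_bound u0 un nu).
have b3 : #|C3| <= b := leq_trans (card_many_left_regular y0 m (15 * u)) (many_regular_bound u0 un nu).
have b4 w : w \in canonical_words n -> #|C4 w| <= b.
  by move=> wW; apply: leq_trans (card_lawful y0 m wW v_le) (lawful_bound u0 un nu).
have cover : num_dualisable_semigroups n <=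
    #|C0 :|: C1 :|: C2 :|: C3 :|: U4 (canonical_words n)|.
  apply/subset_leq_card/fintype.subsetP => op; rewrite unfold_in => /asboolP[opA dual].
  have opA' : A op by apply/asboolP.
  have e0 : (op \in C0) = (m <= #|~: P op|) by rewrite finset.in_set opA'.
  have e1 : (op \in C1) = (#|~: P op| <= m) && `[< ~ has_elbow (binop_mul op) >].
    by rewrite finset.in_set opA'.
  have e2 : (op \in C2) = (#|~: P op| <= m) && (15 * u <= #|right_regular (binop_mul op)|).
    by rewrite finset.in_set opA'.
  have e3 : (op \in C3) = (#|~: P op| <= m) && (15 * u <= #|left_regular (binop_mul op)|).
    by rewrite finset.in_set opA'.
  rewrite 4!finset.in_setU e0 e1 e2 e3.
  have [//|/ltnW Pm] := leqP m #|~: P op|; rewrite Pm /=.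
  have [//|/asboolPn/contrapT elbow] := boolP (`[< ~ has_elbow _ >]).
  have [//|Rq] := leqP (15 * u) #|right_regular _|.
  have [//|Lq] := leqP (15 * u) #|left_regular _|.
  have [//|/existsNP[h /existsNP[s /not_implyP[hs n0s]]]] :=
    dualisable_elbow_free_or_identity opA dual.
  have [w wW lw] := canonical_law opA n0s hs.
  rewrite card_ord in wW; apply/orP; right.
  rewrite finset.in_set; apply/hasP; exists w => //.
  rewrite finset.in_set opA' Pm /=; apply/andP; split; last exact/asboolP.
  (* At least 256u - 5u - 30u = 221u elements are generic, and 221 >= 2 * 109. *)
  have cn : #|~: P op| + #|P op| = n by rewrite addnC cardsC card_ord.
  have := cardsID (right_regular (binop_mul op) :|: left_regular (binop_mul op)) (P op).
  have := (leq_card_setU (right_regular (binop_mul op)) (left_regular (binop_mul op))).1.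
  have := subset_leq_card (finset.subsetIr (P op) (right_regular (binop_mul op) :|: left_regular (binop_mul op))).
  rewrite -/(generic op) -/(P op); move: Pm Rq Lq cn; rewrite /m.
  move: #|~: _| #|_ :&: _| #|generic _| #|_ :|: _| => x1 x2 x3 x4.
  move: #|P _| #|right_regular _| #|left_regular _|; lia.
(* Four classes, and one for each of the ten canonical words. *)
apply: leq_trans cover _; rewrite -[14]/((1 + 1 + 1 + 1) + 10) mulnDl.
apply: leq_trans (leq_card_setU _ _) _; apply: leq_add.
  rewrite !mulnDl mul1n; do 3 (apply: leq_trans (leq_card_setU _ _) _; apply: leq_add => //).
have -> : 10 = size (canonical_words n) by [].
elim: (canonical_words n) b4 => [|w ws IH] b4.
  by rewrite leqn0 cards_eq0; apply/eqP/setP => op; rewrite !finset.inE.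
have -> : U4 (w :: ws) = C4 w :|: U4 ws.
  by apply/setP => op; rewrite finset.in_setU ![_ \in U4 _]finset.in_set.
rewrite /= mulSn; apply: leq_trans (leq_card_setU _ _) _; apply: leq_add.
  by apply: b4; rewrite mem_head.
by apply: IH => w' w'ws; apply: b4; rewrite inE w'ws orbT.
Qed.
Lemma num_dualisable_eventually : exists n0, forall n, n0 <= n ->
  num_dualisable_semigroups n * n.+1 <= num_semigroups n.
Proof.
(* 28 = 14 * 2 comes from the fourteen classes and n + 1 <= 2n; 64 * 64 and 512 bound n / k and n /
   u, rounding included. *)
have [N growthN] := @growth_eventually 28 16 (64 * 64) 512 isT isT.
exists (4 * 256 + N) => n nN.
pose u := n %/ 256; pose k := u %/ 4.
have n1024 : 4 * 256 <= n by apply: leq_trans nN; apply: leq_addr.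
have un : 256 * u <= n by rewrite mulnC leq_divM.
have nu : n < 256 * u.+1 by rewrite mulnC ltn_ceil.
have ku : 4 * k <= u by rewrite mulnC leq_divM.
have uk : u < 4 * k.+1 by rewrite mulnC ltn_ceil.
have u4 : 4 <= u by rewrite leq_divRL.
have k1 : 0 < k by rewrite divn_gt0.
clearbody u k.
have nu' : n <= 512 * u by lia.
have nk : n <= 64 * 64 * k by lia.
have le_un : u <= n by lia.
have le_kn : k <= n by lia.
apply: leq_trans (num_semigroups_ge k1 le_kn).
apply: leq_trans (growthN n u k _ k1 nk ku nu' le_un); last exact: leq_trans (leq_addl _ _) nN.
have u0 : 0 < u by apply: leq_trans u4.
have := num_dualisable_le u0 un nu'.
move: (_ * n ^ _) (num_dualisable_semigroups n) => x y le.
have n0 : 0 < n by lia.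
apply: (@leq_trans (14 * x * (2 * n))); first by apply: leq_mul => //; lia.
by rewrite leq_eqVlt; apply/orP; left; apply/eqP; lia.
Qed.

Import Order.TTheory GRing.Theory Num.Theory.

Local Open Scope classical_set_scope.
Local Open Scope ring_scope.

Theorem corollary5p4 (R : realType) :
  (fun n : nat =>
     (num_dualisable_semigroups n)%:R / (num_semigroups n)%:R : R)
    @ \oo --> (0 : R).
Proof.
have [n0 small] := num_dualisable_eventually.
apply: (squeeze_cvgr _ (cvg_cst 0) (@cvg_harmonic R)).
exists n0 => // n /= n0n; apply/andP; split; first by rewrite divr_ge0.
have [->|s0] := eqVneq (num_semigroups n) 0%N.
  by rewrite invr0 mulr0 invr_ge0.
rewrite ler_pdivrMr ?ltr0n ?lt0n // mulrC ler_pdivlMr ?ltr0n //.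
by rewrite -natrM ler_nat; exact: small.
Qed.
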